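(* Let $S,T$ be self-adjoint and regular operators in the Hilbert-$B$-module $E$, and let $$\mathcal F:=\mathcal F(S,T)=\{x\in\mathcal D(S)\cap\mathcal D(T) : Sx\in\mathcal D(T),\ Tx\in\mathcal D(S)\}.$$ Assume that (1) there are constants $C_0,C_1,C_2>0$ such that for all $x\in\mathcal F$ the inequality $$\langle [S,T]x,[S,T]x\rangle\le C_0\langle x,x\rangle+C_1\langle Sx,Sx\rangle+C_2\langle Tx,Tx\rangle$$ holds in the $C^*$-algebra $B$, where $[S,T]:=ST+TS$; (2) there are a core $\mathcal E\subset\mathcal D(T)$ for $T$ and $\lambda_0>0$ such that $(S+\lambda)^{-1}(\mathcal E)\subset\mathcal F(S,T)$ for all $\lambda\in i\mathbb R$ with $|\lambda|\ge\lambda_0$. Then $S+T$ is self-adjoint and regular on $\mathcal D(S)\cap\mathcal D(T)$. That is, for $z\in\mathbb C\setminus\mathbb R$ and $y\in E$ the equation $Sx+Tx+z\cdot x=y$ has a unique (strong) solution $x\in\mathcal D(S)\cap\mathcal D(T)$.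
   Context: $B$ is a $C^*$-algebra and $E$ is a Hilbert-$C^*$-module over $B$ with $B$-valued inner product $\langle\cdot,\cdot\rangle$; inequalities between elements of $B$ refer to the order of self-adjoint elements of $B$. For a densely defined $B$-linear operator $S$ in $E$, $\mathcal D(S)$ denotes its domain. A self-adjoint operator $S$ in $E$ is regular if $S\pm\lambda$ has dense range for one (hence for all) $\lambda\in\mathbb C\setminus\mathbb R$. A core for $T$ is a submodule of $\mathcal D(T)$ that is dense in $\mathcal D(T)$ for the graph norm of $T$. *)

(* Defs.v *)
From HB Require Import structures.
From mathcomp Require Import all_boot all_order all_algebra.
From mathcomp Require Import all_classical all_reals all_analysis.
From mathcomp Require Import complex.
Set Implicit Arguments.
Unset Strict Implicit.
Unset Printing Implicit Defensive.
Import Order.TTheory GRing.Theory Num.Theory.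
Import numFieldNormedType.Exports.
Local Open Scope classical_set_scope.
Local Open Scope ring_scope.
Local Open Scope complex_scope.

(* MathComp rings are unital, whereas a C*-algebra need not have a unit:
   the product is therefore a new operation on a Banach space. *)
HB.mixin Record isCStarAlgebra (R : realType) (B : Type)
    of CompleteNormedModule R[i] B := {
  cmul : B -> B -> B ;
  cstar : B -> B ;
  cmulA : associative cmul ;
  cmulDl : left_distributive cmul +%R ;
  cmulDr : right_distributive cmul +%R ;
  cmulZl : forall (l : R[i]) a b, cmul (l *: a) b = l *: cmul a b ;
  cmulZr : forall (l : R[i]) a b, cmul a (l *: b) = l *: cmul a b ;
  cstarK : involutive cstar ;
  cstarD : forall a b, cstar (a + b) = cstar a + cstar b ;
  cstarZ : forall (l : R[i]) a, cstar (l *: a) = l^* *: cstar a ;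
  cstarM : forall a b, cstar (cmul a b) = cmul (cstar b) (cstar a) ;
  cnormM : forall a b : B, `|cmul a b| <= `|a| * `|b| ;
  cnorm_star : forall a : B, `|cmul (cstar a) a| = `|a| ^+ 2
}.

#[short(type="cstarAlgType")]
HB.structure Definition CStarAlgebra (R : realType) :=
  {B of isCStarAlgebra R B & CompleteNormedModule R[i] B}.

(* The order of the self-adjoint elements: b - a is positive, i.e. of the form
   c^* c. *)
Definition cstar_le (R : realType) (B : cstarAlgType R) (a b : B) : Prop :=
  exists c : B, b - a = cmul (cstar c) c.

(* Right Hilbert modules, with the inner product linear in its second
   variable.  The norm of the module is |x| = |<x,x>|^(1/2), and completeness
   for it comes from CompleteNormedModule. *)
HB.mixin Record isHilbertModule (R : realType) (B : cstarAlgType R) (E : Type)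
    of CompleteNormedModule R[i] E := {
  bact : E -> B -> E ;
  inner : E -> E -> B ;
  bactDl : forall (x y : E) (b : B), bact (x + y) b = bact x b + bact y b ;
  bactDr : forall (x : E) (a b : B), bact x (a + b) = bact x a + bact x b ;
  bactM : forall (x : E) (a b : B), bact x (cmul a b) = bact (bact x a) b ;
  bactZl : forall (l : R[i]) (x : E) (b : B),
    bact (l *: x) b = l *: bact x b ;
  bactZr : forall (l : R[i]) (x : E) (b : B),
    bact x (l *: b) = l *: bact x b ;
  innerDr : forall x y z : E, inner x (y + z) = inner x y + inner x z ;
  innerZr : forall (l : R[i]) (x y : E), inner x (l *: y) = l *: inner x y ;
  inner_bact : forall (x y : E) (b : B),
    inner x (bact y b) = cmul (inner x y) b ;
  inner_star : forall x y : E, cstar (inner x y) = inner y x ;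
  inner_ge0 : forall x : E, cstar_le 0 (inner x x) ;
  inner_eq0 : forall x : E, inner x x = 0 -> x = 0 ;
  norm_inner : forall x : E, `|x| ^+ 2 = `|inner x x|
}.

#[short(type="hilbertModType")]
HB.structure Definition HilbertModule (R : realType) (B : cstarAlgType R) :=
  {E of isHilbertModule R B E & CompleteNormedModule R[i] E}.

Section Operators.
Context (R : realType) (B : cstarAlgType R) (E : hilbertModType B).

Definition is_submodule (M : set E) : Prop :=
  [/\ M 0,
      forall x y : E, M x -> M y -> M (x + y),
      forall (l : R[i]) (x : E), M x -> M (l *: x)
    & forall (x : E) (b : B), M x -> M (bact x b)].

(* B-linear operators in E; the values of op outside dom are irrelevant. *)
Record operator := Operator {
  dom : set E ;
  op :> E -> E ;
  dom_submodule : is_submodule dom ;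
  opD : forall x y : E, dom x -> dom y -> op (x + y) = op x + op y ;
  opZ : forall (l : R[i]) (x : E), dom x -> op (l *: x) = l *: op x ;
  op_bact : forall (x : E) (b : B), dom x -> op (bact x b) = bact (op x) b
}.

Definition adjoint_graph (S : operator) (y z : E) : Prop :=
  forall x : E, dom S x -> inner (S x) y = inner x z.

(* S is densely defined and the graphs of S and of its adjoint coincide. *)
Definition self_adjoint (S : operator) : Prop :=
  dense (dom S) /\
  forall y z : E, (dom S y /\ S y = z) <-> adjoint_graph S y z.

Definition range_shift (S : operator) (l : R[i]) : set E :=
  [set S x + l *: x | x in dom S].

Definition regular (S : operator) : Prop :=
  exists l : R[i], [/\ complex.Im l != 0,
    dense (range_shift S l) & dense (range_shift S (- l))].

Definition graph_norm (T : operator) (x : E) : R[i] :=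
  sqrtC `|inner x x + inner (T x) (T x)|.

Definition is_core (T : operator) (M : set E) : Prop :=
  [/\ is_submodule M, M `<=` dom T
    & forall x : E, dom T x -> forall e : R[i], 0 < e ->
        exists2 y : E, M y & graph_norm T (x - y) < e].

Definition common_dom (S T : operator) : set E :=
  [set x | [/\ dom S x, dom T x, dom T (S x) & dom S (T x)]].

Definition anticomm (S T : operator) (x : E) : E := S (T x) + T (S x).

(* The set (S + l)^-1 (M). *)
Definition resolvent_image (S : operator) (l : R[i]) (M : set E) : set E :=
  [set x | dom S x /\ M (S x + l *: x)].

Section Sum.
Context (S T : operator).

Lemma sum_dom_submodule : is_submodule (dom S `&` dom T).
Proof.
case: (dom_submodule S) => S0 SD SZ SB; case: (dom_submodule T) => T0 TD TZ TB.
split=> //.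
- by move=> x y [Sx Tx] [Sy Ty]; split; [exact: SD | exact: TD].
- by move=> l x [Sx Tx]; split; [exact: SZ | exact: TZ].
- by move=> x b [Sx Tx]; split; [exact: SB | exact: TB].
Qed.

Lemma sum_opD (x y : E) : (dom S `&` dom T) x -> (dom S `&` dom T) y ->
  S (x + y) + T (x + y) = (S x + T x) + (S y + T y).
Proof. by move=> [Sx Tx] [Sy Ty]; rewrite !opD// addrACA. Qed.

Lemma sum_opZ (l : R[i]) (x : E) : (dom S `&` dom T) x ->
  S (l *: x) + T (l *: x) = l *: (S x + T x).
Proof. by move=> [Sx Tx]; rewrite !opZ// scalerDr. Qed.

Lemma sum_op_bact (x : E) (b : B) : (dom S `&` dom T) x ->
  S (bact x b) + T (bact x b) = bact (S x + T x) b.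
Proof. by move=> [Sx Tx]; rewrite !op_bact// bactDl. Qed.

Definition op_sum : operator :=
  @Operator (dom S `&` dom T) (fun x => S x + T x)
    sum_dom_submodule sum_opD sum_opZ sum_op_bact.

End Sum.
End Operators.

(* Main.v *)
(* The resolvents of [S] preserve [dom T] up to the anticommutator
   [k = ST + TS]: [T (S + ia)^-1 = (S - ia)^-1 (k (S + ia)^-1 - T)]; this holds
   first on the core and then, by closedness, on all of [dom T].  Hence the Yosida
   approximations [Y_a = ia S (S + ia)^-1] anticommute with [T] (in the sense
   [T Y_a + Y_a^* T]) up to [a^2 (S - ia)^-1 k (S + ia)^-1], an error controlled
   by [|x| + |Y_a x| + |T x|].  As [Im Y_a >= 0], the operators
   [Y_a + T + i mu] are bounded below, uniformly in [a], by
   [|Y_a x| + |T x| + mu |x|] once [mu] is large, and they are onto as bounded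
   perturbations of [T + i mu].

   Let [y] be in [dom S], let [x] solve [Y_a x + T x + i mu x = y], and let
   [G = a^2 (S^2 + a^2)^-1].  Applying [S G] to the equation and using the lower
   bound for [Y_a - T + i mu] bounds [Y_a S G x] independently of [a].  Since
   [S G - G Y_a = (ia)^-1 Y_a S G], this shows that [w = G x], which lies in
   the domain of the anticommutator, satisfies [(S + T + i mu) w = y + O(1/a)].
   So [S + T + i mu] has dense range; the lower bound for [S + T + i mu] on
   that domain makes it onto [E].

   No duality argument is used, because a proper closed submodule of a Hilbert
   module can have trivial orthogonal complement.  The order of [B] enters only
   through [|a|^2 <= |a^* a + y|] for positive [y], which rests on Kaplansky's
   theorem that [c^* c] has nonnegative spectrum. *)

Require Import Defs.
From HB Require Import structures.
From mathcomp Require Import all_boot all_order all_algebra.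
From mathcomp Require Import all_classical all_reals all_analysis.
From mathcomp Require Import complex ring lra.
Set Implicit Arguments.
Unset Strict Implicit.
Unset Printing Implicit Defensive.
Import Order.TTheory GRing.Theory Num.Theory.
Import numFieldNormedType.Exports.
Local Open Scope classical_set_scope.
Local Open Scope ring_scope.
Local Open Scope complex_scope.

(** * Linear identities in modules over the complex numbers *)

(* Reflexive proofs of linear identities in modules: [lmodule R V] reduces an
   equation between linear combinations to the equality of the coefficients of
   each atom, which [cring] decides through real and imaginary parts. *)
Inductive mexp (K : Type) : Type :=
  | MVar of nat | MZero | MAdd of mexp K & mexp K | MOpp of mexp K
  | MScale of K & mexp K.
Arguments MVar {K}.
Arguments MZero {K}.

Fixpoint meval (K : pzRingType) (V : lmodType K) (env : nat -> V) (e : mexp K) : V :=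
  match e with
  | MVar i => env i
  | MZero => 0
  | MAdd a b => meval env a + meval env b
  | MOpp a => - meval env a
  | MScale k a => k *: meval env a
  end.

Fixpoint mcoef (K : pzRingType) (i : nat) (e : mexp K) : K :=
  match e with
  | MVar j => if Nat.eqb j i then 1 else 0
  | MZero => 0
  | MAdd a b => mcoef i a + mcoef i b
  | MOpp a => - mcoef i a
  | MScale k a => k * mcoef i a
  end.

Fixpoint mwf (K : Type) (n : nat) (e : mexp K) : bool :=
  match e with
  | MVar j => Nat.ltb j n
  | MZero => true
  | MAdd a b => mwf n a && mwf n b
  | MOpp a => mwf n a
  | MScale k a => mwf n a
  end.

Fixpoint magree (K : pzRingType) (n : nat) (e f : mexp K) : Prop :=
  match n with
  | 0 => True
  | m.+1 => mcoef m e = mcoef m f /\ magree m e f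
  end.

Lemma meval_sum (K : pzRingType) (V : lmodType K) (env : nat -> V) n e :
  mwf n e -> meval env e = \sum_(i < n) mcoef i e *: env i.
Proof.
elim: e => [j|| a IHa b IHb | a IHa | k a IHa] /=.
- move=> /PeanoNat.Nat.ltb_lt/ssrnat.ltP jn.
  rewrite (bigD1 (Ordinal jn)) //= PeanoNat.Nat.eqb_refl scale1r big1 ?addr0//.
  move=> i /eqP ij; case: PeanoNat.Nat.eqb_spec => [e|]; last by rewrite scale0r.
  by case: ij; apply/val_inj.
- by rewrite big1// => i _; rewrite scale0r.
- move=> /andP[/IHa -> /IHb ->].
  by rewrite -big_split; apply: eq_bigr => i _; rewrite scalerDl.
- by move=> /IHa ->; rewrite -sumrN; apply: eq_bigr => i _; rewrite scaleNr.
- by move=> /IHa ->; rewrite scaler_sumr; apply: eq_bigr => i _; rewrite scalerA.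
Qed.

Lemma meval_eq (K : pzRingType) (V : lmodType K) (env : nat -> V) n e f :
  mwf n e -> mwf n f -> magree n e f -> meval env e = meval env f.
Proof.
move=> we wf; rewrite (meval_sum env we) (meval_sum env wf) => H.
apply: eq_bigr => i _; congr (_ *: _).
elim: n {we wf} i H => [[]//|n IH] i /= [e0 e1].
have := ltn_ord i; rewrite ltnS leq_eqVlt => /orP[/eqP -> //|lt].
exact: (IH (Ordinal lt)).
Qed.

Ltac madd x env :=
  let rec isin l :=
    lazymatch l with
    | nil => constr:(false)
    | x :: _ => constr:(true)
    | _ :: ?l' => isin l'
    end in
  lazymatch isin env with true => constr:(env) | false => constr:(x :: env) end.

Ltac menv t env :=
  lazymatch t with
  | GRing.add ?a ?b => let e := menv a env in menv b e
  | GRing.opp ?a => menv a env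
  | GRing.scale ?k ?a => menv a env
  | GRing.zero => constr:(env)
  | _ => madd t env
  end.

Ltac mindex t env :=
  lazymatch env with
  | t :: _ => constr:(0%N)
  | _ :: ?l => let n := mindex t l in constr:(n.+1)
  end.

Ltac mquote K t env :=
  lazymatch t with
  | GRing.add ?a ?b =>
      let a' := mquote K a env in let b' := mquote K b env in
      constr:(@MAdd (K) a' b')
  | GRing.opp ?a => let a' := mquote K a env in constr:(@MOpp K a')
  | GRing.scale ?k ?a => let a' := mquote K a env in constr:(@MScale K k a')
  | GRing.zero => constr:(@MZero K)
  | _ => let i := mindex t env in constr:(@MVar K i)
  end.

Ltac msize env :=
  lazymatch env with
  | nil => constr:(0%N)
  | _ :: ?l => let n := msize l in constr:(n.+1)
  end.

Ltac lmodule_with R V :=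
  lazymatch goal with
  | |- ?a = ?b =>
      let env := menv a (@nil V) in
      let env := menv b env in
      let e := mquote (R[i]) a env in
      let f := mquote (R[i]) b env in
      let n := msize env in
      refine (@meval_eq _ _ (fun i => nth 0 env i) n e f isT isT _);
      cbn [magree mcoef Nat.eqb]; repeat split
  end.

Ltac cring :=
  first
  [ ring
  | apply/eqP; rewrite eq_complex /=; apply/andP; split; apply/eqP;
    first [ring | field; try exact/lt0r_neq0] ].
Ltac lmodule R V := lmodule_with R V; cring.

(** * Real-valued norms and convergence *)

Section RealNorm.
Context (R : realType).

(* The norm, which takes values in R[i], as a real number. *)
Definition rnorm (V : normedModType R[i]) (x : V) : R := complex.Re `|x|.

Local Notation "`‖ x ‖" := (rnorm x) (at level 0, format "`‖ x ‖").

Context (V : normedModType R[i]).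
Implicit Types x y z : V.

Lemma rnormE x : `|x| = `‖x‖%:C.
Proof.
by rewrite [LHS]complexE (ger0_Im (normr_ge0 x)) mulr0 addr0.
Qed.

Lemma rnorm_ge0 x : 0 <= `‖x‖.
Proof. by rewrite -ler0c -rnormE. Qed.

Lemma rnorm0 : `‖(0 : V)‖ = 0.
Proof. by rewrite /rnorm normr0. Qed.

Lemma rnorm_eq0 x : `‖x‖ = 0 -> x = 0.
Proof. by move=> x0; apply/eqP; rewrite -normr_eq0 rnormE x0. Qed.

Lemma rnormD x y : `‖x + y‖ <= `‖x‖ + `‖y‖.
Proof. by have := ler_normD x y; rewrite !rnormE -rmorphD lecR. Qed.

Lemma rnormN x : `‖- x‖ = `‖x‖.
Proof. by rewrite /rnorm normrN. Qed.

Lemma rnormB x y : `‖x - y‖ <= `‖x‖ + `‖y‖.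
Proof. by rewrite -(rnormN y); exact: rnormD. Qed.

Lemma rdistC x y : `‖x - y‖ = `‖y - x‖.
Proof. by rewrite -rnormN opprB. Qed.

Lemma rdist_trans x y z : `‖x - z‖ <= `‖x - y‖ + `‖y - z‖.
Proof. by have := rnormD (x - y) (y - z); rewrite addrA subrK. Qed.

Lemma rnormZ (r : R) x : `‖r%:C *: x‖ = `|r| * `‖x‖.
Proof.
rewrite /rnorm normrZ -/(rnorm x) rnormE normc_def /= expr0n addr0 sqrtr_sqr.
by rewrite mul0r subr0.
Qed.

Lemma rnormZi x : `‖'i *: x‖ = `‖x‖.
Proof.
rewrite /rnorm normrZ normc_def /= expr0n add0r expr1n sqrtr1.
by rewrite mul1r.
Qed.

Lemma rnormZir (r : R) x : `‖('i * r%:C) *: x‖ = `|r| * `‖x‖.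
Proof. by rewrite -scalerA rnormZi rnormZ. Qed.

End RealNorm.

Notation "`‖ x ‖" := (rnorm x) (at level 0, format "`‖ x ‖").

Section Convergence.
Context (R : realType) (V : completeNormedModType R[i]).
Implicit Types (u v : nat -> V) (l x : V).

Definition tends u l : Prop :=
  forall e : R, 0 < e -> exists N, forall n, (N <= n)%N -> `‖u n - l‖ < e.

Definition cauchy_seq u : Prop :=
  forall e : R, 0 < e ->
    exists N, forall m n, (N <= m)%N -> (N <= n)%N -> `‖u m - u n‖ < e.

Lemma cauchy_seq_tends u : cauchy_seq u -> exists l, tends u l.
Proof.
move=> cu.
have : cauchy (u @ \oo).
  apply/cauchy_exP => e /= e0.
  have ere : e = (complex.Re e)%:C.
    by rewrite [LHS]complexE (ger0_Im (ltW e0)) mulr0 addr0.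
  move: e0; rewrite ere ltcR => /cu[N HN].
  exists (u N), N => // n /= Nn.
  by rewrite -ball_normE /ball_/= rnormE ltcR; apply: HN.
move=> /cauchy_cvg cvu; exists (lim (u @ \oo)) => e e0.
have /cvgrPdist_lt/(_ e%:C) := cvu; rewrite ltcR => /(_ e0) [N _ HN].
by exists N => n /HN /=; rewrite rnormE ltcR rdistC.
Qed.

Lemma tends_uniq u l l' : tends u l -> tends u l' -> l = l'.
Proof.
move=> ul ul'; apply/eqP; rewrite -subr_eq0; apply/eqP/rnorm_eq0/eqP.
rewrite eq_le rnorm_ge0 andbT; apply/ler_addgt0Pr => e e0; rewrite add0r.
have e20 : 0 < e / 2 by rewrite divr_gt0.
have [N HN] := ul _ e20; have [M HM] := ul' _ e20.
have := HN _ (leq_maxl N M); have := HM _ (leq_maxr N M).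
have := rdist_trans l (u (maxn N M)) l'; rewrite (rdistC l (u _)).
move=> ? ? ?; lra.
Qed.

Lemma tends_cauchy u l : tends u l -> cauchy_seq u.
Proof.
move=> ul e e0; have [|N HN] := ul (e / 2); first by rewrite divr_gt0.
exists N => m n /HN um /HN un.
by have := rdist_trans (u m) l (u n); rewrite (rdistC l); lra.
Qed.

Lemma tends_le u l (c : R) : tends u l -> (forall n, `‖u n‖ <= c) -> `‖l‖ <= c.
Proof.
move=> ul uc; apply/ler_addgt0Pr => e /ul[N /(_ N (leqnn N))].
by have := rnormB (u N) (u N - l); have := uc N; rewrite subKr; lra.
Qed.

Lemma tendsD u v l l' : tends u l -> tends v l' ->
  tends (fun n => u n + v n) (l + l').
Proof.
move=> ul vl e e0; have e20 : 0 < e / 2 by rewrite divr_gt0.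
have [N HN] := ul _ e20; have [M HM] := vl _ e20.
exists (maxn N M) => n; rewrite geq_max => /andP[/HN + /HM].
have := rnormD (u n - l) (v n - l'); rewrite opprD addrACA.
by move=> ? ? ?; lra.
Qed.

(** The real sequence [r] is nondecreasing and bounded, hence Cauchy, and its increments dominate
    those of [u]. *)
Lemma tends_summable u (r : nat -> R) (c : R) :
  (forall n, `‖u n.+1 - u n‖ <= r n.+1 - r n) -> (forall n, r n <= c) ->
  exists l, tends u l.
Proof.
move=> ur rc; apply: cauchy_seq_tends.
have step m k : `‖u (m + k)%N - u m‖ <= r (m + k)%N - r m.
  elim: k => [|k IH]; first by rewrite addn0 !subrr rnorm0.
  have := rdist_trans (u (m + k.+1)%N) (u (m + k)%N) (u m).
  by have := ur (m + k)%N; rewrite -addnS; lra.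
have rm m k : r m <= r (m + k)%N.
  by have := step m k; have := rnorm_ge0 (u (m + k)%N - u m); lra.
move=> e e0.
have hs : has_sup (range r).
  split; first by exists (r 0%N), 0%N.
  by exists c => _ [n _ <-].
have [|_ [N _ <-] HN] := @sup_adherent _ (range r) (e / 2) _ hs.
  by rewrite divr_gt0.
have up n : r n <= sup (range r) by apply: ub_le_sup; [case: hs|exists n].
exists N => m n Nm Nn.
have := rdist_trans (u m) (u N) (u n); rewrite (rdistC (u N) (u n)).
have := step N (m - N)%N; have := step N (n - N)%N; rewrite !subnKC//.
by have := up m; have := up n; lra.
Qed.

End Convergence.

Lemma tends_lip (R : realType) (V W : completeNormedModType R[i]) (f : V -> W)
    (c : R) (u : nat -> V) (l : V) :
  (forall n, `‖f (u n) - f l‖ <= c * `‖u n - l‖) -> tends u l ->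
  tends (fun n => f (u n)) (f l).
Proof.
move=> fl ul e e0.
have c1 : 0 < `|c| + 1 by rewrite ltr_wpDl.
have [|N HN] := ul (e / (`|c| + 1)); first by rewrite divr_gt0.
exists N => n /HN; rewrite ltr_pdivlMr// => un; apply: le_lt_trans un.
apply: (le_trans (fl n)); rewrite mulrC ler_wpM2l ?rnorm_ge0//.
by have := ler_norm c; lra.
Qed.

(** * Positive elements of a C*-algebra *)

Section CStar.
Context (R : realType) (B : cstarAlgType R).
Implicit Types (a b c d : B) (f g h : B -> B).

Local Notation "a ** b" := (cmul a b) (at level 40, left associativity).

Lemma cmul0l b : 0 ** b = 0.
Proof. by rewrite -[X in X ** _](scale0r b) cmulZl scale0r. Qed.

Lemma cmulNl a b : (- a) ** b = - (a ** b).
Proof. by rewrite -scaleN1r cmulZl scaleN1r. Qed.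

Lemma cmul0r b : b ** 0 = 0.
Proof. by rewrite -[X in _ ** X](scale0r b) cmulZr scale0r. Qed.

Lemma cmulNr a b : a ** (- b) = - (a ** b).
Proof. by rewrite -scaleN1r cmulZr scaleN1r. Qed.

Lemma cstar0 : cstar (0 : B) = 0.
Proof. by rewrite -[X in cstar X](scale0r (0 : B)) cstarZ rmorph0 scale0r. Qed.

Lemma cstarN a : cstar (- a) = - cstar a.
Proof.
apply/eqP; rewrite -addr_eq0; apply/eqP.
by rewrite -cstarD addNr cstar0.
Qed.

Lemma rnormM a b : `‖a ** b‖ <= `‖a‖ * `‖b‖.
Proof. by have := cnormM a b; rewrite !rnormE -rmorphM lecR. Qed.

Lemma rnorm_cstarM a : `‖cstar a ** a‖ = `‖a‖ ^+ 2.
Proof. by have := cnorm_star a; rewrite !rnormE -rmorphXn => /complexI. Qed.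

Lemma rnorm_star a : `‖cstar a‖ = `‖a‖.
Proof.
have le c : `‖c‖ <= `‖cstar c‖.
  have := rnormM (cstar c) c; rewrite rnorm_cstarM expr2.
  have := rnorm_ge0 c; rewrite le_eqVlt => /orP[/eqP <- _|c0].
    exact: rnorm_ge0.
  by rewrite ler_pM2r.
by apply/eqP; rewrite eq_le le andbT -[X in _ <= `‖X‖]cstarK le.
Qed.

(** The inner product of [B] as a Hilbert module over itself. Positivity is studied for adjointable
    operators on this module, among which there is an identity even if [B] has no unit. *)
Definition ip b c := cstar b ** c.

Lemma ipDl a b c : ip (a + b) c = ip a c + ip b c.
Proof. by rewrite /ip cstarD cmulDl. Qed.
Lemma ipDr a b c : ip a (b + c) = ip a b + ip a c.
Proof. by rewrite /ip cmulDr. Qed.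
Lemma ipNl a b : ip (- a) b = - ip a b.
Proof. by rewrite /ip cstarN cmulNl. Qed.
Lemma ipNr a b : ip a (- b) = - ip a b.
Proof. by rewrite /ip cmulNr. Qed.
Lemma ipZl k a b : ip (k *: a) b = k^* *: ip a b.
Proof. by rewrite /ip cstarZ cmulZl. Qed.
Lemma ipZr k a b : ip a (k *: b) = k *: ip a b.
Proof. by rewrite /ip cmulZr. Qed.
Definition ipE := (ipDl, ipDr, ipNl, ipNr, ipZl, ipZr).

Lemma ip_star a b : cstar (ip a b) = ip b a.
Proof. by rewrite /ip cstarM cstarK. Qed.

Lemma ip_norm a b : `‖ip a b‖ <= `‖a‖ * `‖b‖.
Proof. by rewrite -(rnorm_star a); exact: rnormM. Qed.

Lemma ip_inj a b : (forall c, ip c a = ip c b) -> a = b.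
Proof.
move=> H; apply/eqP; rewrite -subr_eq0; apply/eqP/rnorm_eq0.
have := rnorm_cstarM (a - b); rewrite -/(ip _ _) ipDr ipNr H subrr rnorm0.
by move=> /esym/eqP; rewrite sqrf_eq0 => /eqP.
Qed.

(** The existence of an adjoint already forces [f] to be linear, since [ip] separates points. *)
Definition adj f g := forall b c, ip (f b) c = ip b (g c).

Definition bounded f := exists k, 0 < k /\ forall b, `‖f b‖ <= k * `‖b‖.

Definition bsa f := adj f f /\ bounded f.

Definition commutes f g := forall b, f (g b) = g (f b).

Lemma adj_sym f g : adj f g -> adj g f.
Proof. by move=> fg b c; rewrite -ip_star -fg ip_star. Qed.

Lemma adj_add f g : adj f g -> forall b c, f (b + c) = f b + f c.
Proof. by move=> /adj_sym fg b c; apply: ip_inj => d; rewrite -fg !ipE !fg. Qed.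

Lemma adj_opp f g : adj f g -> forall b, f (- b) = - f b.
Proof. by move=> /adj_sym fg b; apply: ip_inj => d; rewrite -fg !ipE !fg. Qed.

Lemma adj_scale f g : adj f g -> forall k b, f (k *: b) = k *: f b.
Proof. by move=> /adj_sym fg k b; apply: ip_inj => d; rewrite -fg !ipE !fg. Qed.

Lemma adj_zero f g : adj f g -> f 0 = 0.
Proof. by move=> fg; have := adj_scale fg 0 0; rewrite !scale0r. Qed.

(* [f + i g] and [f - i g] are adjoint to each other and commute, hence have
   the same norm at every vector, and [2 f] is their sum. *)
Lemma sqr_le_sum_sqr f g (k : R) : adj f f -> adj g g -> commutes f g ->
  (forall b, `‖f (f b) + g (g b)‖ <= k * `‖b‖) ->
  forall b, `‖f b‖ ^+ 2 <= k * `‖b‖ ^+ 2.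
Proof.
move=> ff gg fg H b.
have e1 : ip (f b + 'i *: g b) (f b + 'i *: g b) = ip b (f (f b) + g (g b)).
  by rewrite !ipE !ff !gg fg; lmodule R B.
have e2 : ip (f b - 'i *: g b) (f b - 'i *: g b) = ip b (f (f b) + g (g b)).
  by rewrite !ipE !ff !gg fg; lmodule R B.
have := rnorm_cstarM (f b + 'i *: g b); rewrite -/(ip _ _) e1.
have := rnorm_cstarM (f b - 'i *: g b); rewrite -/(ip _ _) e2.
have := ip_norm b (f (f b) + g (g b)).
have := H b; have := rnorm_ge0 b.
have := rnormD (f b + 'i *: g b) (f b - 'i *: g b).
have -> : f b + 'i *: g b + (f b - 'i *: g b) = (2 : R)%:C *: f b by lmodule R B.
rewrite rnormZ ger0_norm//.
have := rnorm_ge0 (f b + 'i *: g b); have := rnorm_ge0 (f b - 'i *: g b).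
have := rnorm_ge0 (f b).
move: (`‖f b‖) (`‖b‖) (`‖f b + _‖) (`‖f b - _‖) (`‖ip _ _‖) (`‖f (f b) + _‖).
move=> x y p q r s x0 q0 p0 xpq y0 sk rys q2 p2.
have pq : p = q by apply/eqP; rewrite -(eqrXn2 (ltn0Sn 1))// -p2 -q2.
subst q; have : x <= p by lra.
by move=> xp; nra.
Qed.

(** * Square roots of [1 - f] for self-adjoint contractions [f] *)

Section SquareRootIteration.
Context (f : B -> B) (f_sa : adj f f) (f_le1 : forall b, `‖f b‖ <= `‖b‖).

(** The iteration [s' = (f + s^2) / 2] from 0, whose limit satisfies [(1 - s)^2 = 1 - f]. The
    scalars [sqrt_bound] follow the same recursion with [f = 1] and dominate it. *)
Fixpoint sqrt_it n b : B :=
  if n is m.+1 then (2^-1)%:C *: (f b + sqrt_it m (sqrt_it m b)) else 0.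

Fixpoint sqrt_bound n : R :=
  if n is m.+1 then 2^-1 * (1 + sqrt_bound m ^+ 2) else 0.

Lemma sqrt_bound_ge0 n : 0 <= sqrt_bound n.
Proof. by elim: n => //= n IH; rewrite mulr_ge0// addr_ge0// sqr_ge0. Qed.

Lemma sqrt_bound_le1 n : sqrt_bound n <= 1.
Proof. by elim: n => //= n IH; have := sqrt_bound_ge0 n; nra. Qed.

Lemma sqrt_it_sa n : adj (sqrt_it n) (sqrt_it n).
Proof.
elim: n => [b c|n IH b c] /=; first by rewrite /ip cstar0 cmul0l cmul0r.
by rewrite !ipE f_sa !IH; lmodule R B.
Qed.

Lemma sqrt_it_le n b : `‖sqrt_it n b‖ <= sqrt_bound n * `‖b‖.
Proof.
elim: n b => [b|n IH b] /=; first by rewrite rnorm0 mul0r.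
rewrite rnormZ ger0_norm ?invr_ge0//.
have := rnormD (f b) (sqrt_it n (sqrt_it n b)); have := f_le1 b.
have := IH b; have := IH (sqrt_it n b); have := sqrt_bound_ge0 n.
by move=> ? ? ? ? ?; nra.
Qed.

(** For consecutive iterates, [u^2 - v^2 = u (u - v) + (u - v) v]. The increments of [sqrt_bound]
    satisfy the scalar form of this identity, so the induction compares term by term. *)
Lemma sqrt_it_step n b :
  `‖sqrt_it n.+1 b - sqrt_it n b‖ <= (sqrt_bound n.+1 - sqrt_bound n) * `‖b‖.
Proof.
elim: n b => [b|n IH b].
  by rewrite subr0; have := sqrt_it_le 1 b; rewrite subr0.
set u := sqrt_it n.+1 in IH *; set v := sqrt_it n in IH *.
have -> : sqrt_it n.+2 b - u b =
    (2^-1)%:C *: (u (u b - v b) + (u (v b) - v (v b))).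
  have -> : u (u b - v b) = u (u b) - u (v b).
    by rewrite /u (adj_add (@sqrt_it_sa n.+1)) (adj_opp (@sqrt_it_sa n.+1)).
  have e1 : u b = (2^-1)%:C *: (f b + v (v b)) by [].
  have -> : sqrt_it n.+2 b = (2^-1)%:C *: (f b + u (u b)) by [].
  by rewrite [X in _ - X = _]e1; lmodule R B.
rewrite rnormZ ger0_norm ?invr_ge0//.
have := rnormD (u (u b - v b)) (u (v b) - v (v b)).
have := sqrt_it_le n.+1 (u b - v b); rewrite -/u.
have := IH b; have := IH (v b); have := sqrt_it_le n b; rewrite -/v.
have := sqrt_bound_ge0 n.+1; have := sqrt_bound_ge0 n.
have -> : sqrt_bound n.+2 = 2^-1 * (1 + sqrt_bound n.+1 ^+ 2) by [].
have : 0 <= sqrt_bound n.+1 - sqrt_bound n.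
  by rewrite /=; have := sqr_ge0 (1 - sqrt_bound n); lra.
have : sqrt_bound n.+1 = 2^-1 * (1 + sqrt_bound n ^+ 2) by [].
move: (sqrt_bound n.+1) (sqrt_bound n) => s r er rs r0 s0 hv h1 h2 h3 h4.
have h5 : (s - r) * `‖v b‖ <= (s - r) * (r * `‖b‖) by rewrite ler_wpM2l.
have h6 : s * `‖u b - v b‖ <= s * ((s - r) * `‖b‖) by rewrite ler_wpM2l.
have h7 : (2^-1 * (1 + s ^+ 2) - s) * `‖b‖ =
   2^-1 * ((s - r) * (r * `‖b‖) + s * ((s - r) * `‖b‖)).
  by rewrite {2}er; field.
by lra.
Qed.

Lemma sqrt_it_comm g n : bsa g -> commutes g f -> commutes g (sqrt_it n).
Proof.
move=> [gg _] gf; elim: n => [|n IH] b /=; first by rewrite (adj_zero gg).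
by rewrite (adj_scale gg) (adj_add gg) gf !IH.
Qed.

(** The iterates converge pointwise. The limit inherits self-adjointness and, the iterates being
    polynomials in [f], commutes with whatever bounded self-adjoint operator commutes with [f]. *)
Lemma sqrt_exists : exists s, [/\ adj s s, forall b, `‖s b‖ <= `‖b‖,
  forall b, s b = (2^-1)%:C *: (f b + s (s b))
  & forall g, bsa g -> commutes g f -> commutes g s].
Proof.
have H b : exists l, tends (fun n => sqrt_it n b) l.
  apply: (@tends_summable _ _ _ (fun n => sqrt_bound n * `‖b‖) `‖b‖) => n.
    by rewrite -mulrBl; exact: sqrt_it_step.
  by rewrite ler_piMl ?rnorm_ge0// sqrt_bound_le1.
have [s Hs] := choice H.
have sle b : `‖s b‖ <= `‖b‖.
  apply: (tends_le (Hs b)) => n; apply: (le_trans (sqrt_it_le n b)).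
  by rewrite ler_piMl ?rnorm_ge0// sqrt_bound_le1.
have itle n b : `‖sqrt_it n b‖ <= `‖b‖.
  apply: (le_trans (sqrt_it_le n b)).
  by rewrite ler_piMl ?rnorm_ge0// sqrt_bound_le1.
exists s; split=> //.
- move=> b c.
  have h1 : tends (fun n => ip (sqrt_it n b) c) (ip (s b) c).
    apply: (@tends_lip _ _ _ (fun x => ip x c) `‖c‖) (Hs b) => n.
    by rewrite -ipNl -ipDl mulrC; exact: ip_norm.
  apply: (tends_uniq h1) => e e0.
  have [|N HN] := @tends_lip _ _ _ (fun x => ip b x) `‖b‖ _ _ _ (Hs c) e e0.
    by move=> n; rewrite -ipNr -ipDr; exact: ip_norm.
  by exists N => n /HN; rewrite (@sqrt_it_sa n).
- move=> b.
  have h1 : tends (fun n => sqrt_it n (sqrt_it n b)) (s (s b)).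
    move=> e e0; have e2 : 0 < e / 2 by rewrite divr_gt0.
    have [N HN] := Hs b _ e2; have [M HM] := Hs (s b) _ e2.
    exists (maxn N M) => n; rewrite geq_max => /andP[/HN + /HM].
    have := itle n (sqrt_it n b - s b).
    rewrite (adj_add (@sqrt_it_sa n)) (adj_opp (@sqrt_it_sa n)).
    have := rdist_trans (sqrt_it n (sqrt_it n b)) (sqrt_it n (s b)) (s (s b)).
    by move=> ? ? ? ?; lra.
  have h2 : tends (fun n => sqrt_it n.+1 b) (s b).
    by move=> e /(Hs b)[N HN]; exists N => n Nn; apply: HN; exact: leqW.
  apply: (tends_uniq h2) => e e0; have [N HN] := h1 e e0.
  exists N => n /HN /=; apply: le_lt_trans.
  have -> : (2^-1)%:C *: (f b + sqrt_it n (sqrt_it n b)) -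
    (2^-1)%:C *: (f b + s (s b)) =
    (2^-1)%:C *: (sqrt_it n (sqrt_it n b) - s (s b)) by lmodule R B.
  rewrite rnormZ ger0_norm ?invr_ge0//.
  by have := rnorm_ge0 (sqrt_it n (sqrt_it n b) - s (s b)); lra.
- move=> g gsa gf b; have [gg [k [_ gk]]] := gsa.
  have h1 : tends (fun n => g (sqrt_it n b)) (g (s b)).
    apply: (tends_lip _ (Hs b)) => n; rewrite -(adj_opp gg) -(adj_add gg); exact: gk.
  apply: (tends_uniq h1) => e e0; have [N HN] := Hs (g b) e e0.
  by exists N => n /HN; rewrite (sqrt_it_comm _ gsa gf).
Qed.

End SquareRootIteration.

(** * Bounded self-adjoint operators and the cone of positive operators *)

Lemma bsa_comp_scale g (k : R) : bsa g -> bsa (fun b => k%:C *: g b).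
Proof.
move=> [gg [c [c0 gc]]]; split=> [x y|].
  by rewrite !ipE gg; lmodule R B.
exists (`|k| * c + 1); split.
  by rewrite ltr_wpDl// mulr_ge0 ?normr_ge0// ltW.
move=> b; rewrite rnormZ mulrDl mul1r -mulrA.
by rewrite ler_wpDr ?rnorm_ge0// ler_wpM2l ?normr_ge0.
Qed.

Lemma bsaD f g : bsa f -> bsa g -> bsa (fun b => f b + g b).
Proof.
move=> [ff [c [c0 fc]]] [gg [k [k0 gk]]]; split=> [x y|].
  by rewrite !ipE ff gg.
exists (c + k); split; first exact: addr_gt0.
by move=> b; rewrite mulrDl (le_trans (rnormD _ _))// lerD.
Qed.

Lemma bsa_id : bsa id.
Proof. by split=> //; exists 1; split=> // b; rewrite mul1r. Qed.

Lemma bsa_comp f g : bsa f -> bsa g -> commutes f g -> bsa (f \o g).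
Proof.
move=> [ff [c [c0 fc]]] [gg [k [k0 gk]]] fg; split=> [x y|].
  by rewrite /= ff gg fg.
exists (c * k); split; first exact: mulr_gt0.
move=> b; apply: (le_trans (fc _)); rewrite -mulrA ler_wpM2l//.
exact: ltW.
Qed.

(** Take [v = 1 - s] with [s = (f + s^2) / 2]: then [v^2 = 1 - 2 s + s^2 = 1 - f]. *)
Lemma sqrt_compl f : adj f f -> (forall b, `‖f b‖ <= `‖b‖) ->
  exists v, [/\ bsa v, forall b, v (v b) = b - f b,
    forall b, `‖b - v b‖ <= `‖b‖
  & forall g, bsa g -> commutes g f -> commutes g v].
Proof.
move=> ff f1; have [s [ss s1 sE sC]] := sqrt_exists ff f1.
have sbsa : bsa s by split=> //; exists 1; split=> // b; rewrite mul1r.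
have vE b : b - s b = id b + (-1)%:C *: s b by lmodule R B.
exists (fun b => b - s b); split.
- have [h1 h2] := bsaD bsa_id (bsa_comp_scale (-1) sbsa).
  split=> [b c|]; first by rewrite !vE h1.
  by case: h2 => k [k0 hk]; exists k; split=> // b; rewrite vE hk.
- move=> b; rewrite (adj_add ss) (adj_opp ss).
  have -> : s (s b) = (2 : R)%:C *: s b - f b.
    by rewrite [in RHS]sE; lmodule R B.
  by lmodule R B.
- by move=> b; rewrite subKr.
- by move=> g gb gf b; rewrite (adj_add gb.1) (adj_opp gb.1) sC.
Qed.

Lemma sqrt_near1 f : bsa f -> (forall b, `‖b - f b‖ <= `‖b‖) ->
  exists v, [/\ bsa v, forall b, v (v b) = f b,
    forall b, `‖b - v b‖ <= `‖b‖
  & forall g, bsa g -> commutes g f -> commutes g v].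
Proof.
move=> [ff fb] f1.
have h1 : adj (fun b => b - f b) (fun b => b - f b).
  by move=> b c; rewrite !ipE ff.
have [v [v1 v2 v3 v4]] := sqrt_compl h1 f1.
exists v; split=> // [b|g gb gf]; first by rewrite v2 subKr.
by apply: v4 => // b; rewrite (adj_add gb.1) (adj_opp gb.1) gf.
Qed.

(* The cone of positive operators; the inequality says that the spectrum of
   a self-adjoint [f] lies in [0, 2t]. *)
Definition opos f := exists t : R, 0 < t /\ forall b, `‖t%:C *: b - f b‖ <= t * `‖b‖.

Lemma opos_large f (t t' : R) : (forall b, `‖t%:C *: b - f b‖ <= t * `‖b‖) ->
  t <= t' -> forall b, `‖t'%:C *: b - f b‖ <= t' * `‖b‖.
Proof.
move=> h tt' b.
have -> : t'%:C *: b - f b = (t' - t)%:C *: b + (t%:C *: b - f b) by lmodule R B.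
rewrite (le_trans (rnormD _ _))// rnormZ ger0_norm ?subr_ge0//.
by have := h b; lra.
Qed.

Lemma oposD f g : opos f -> opos g -> opos (fun b => f b + g b).
Proof.
move=> [t [t0 ft]] [s [s0 gs]]; exists (t + s); split; first exact: addr_gt0.
move=> b; have -> : (t + s)%:C *: b - (f b + g b) =
  (t%:C *: b - f b) + (s%:C *: b - g b) by lmodule R B.
by rewrite mulrDl (le_trans (rnormD _ _))// lerD.
Qed.

Lemma oposZ f (k : R) : 0 < k -> opos f -> opos (fun b => k%:C *: f b).
Proof.
move=> k0 [t [t0 ft]]; exists (k * t); split; first exact: mulr_gt0.
move=> b; have -> : (k * t)%:C *: b - k%:C *: f b = k%:C *: (t%:C *: b - f b).
  by lmodule R B.
by rewrite rnormZ gtr0_norm// -mulrA ler_pM2l.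
Qed.

(** With [v^2 = 1 - f^2], the sum [v^2 + f^2] is the identity. So [v] is a contraction by
    [sqr_le_sum_sqr], and hence so is [v^2]. *)
Lemma opos_sqr1 f : bsa f -> (forall b, `‖f b‖ <= `‖b‖) ->
  forall b, `‖b - f (f b)‖ <= `‖b‖.
Proof.
move=> fb f1.
have [v [vb v2 v3 v4]] := @sqrt_compl (f \o f) (bsa_comp fb fb (fun=> erefl)).1
  (fun b => le_trans (f1 (f b)) (f1 b)).
have vle b : `‖v b‖ <= `‖b‖.
  have := @sqr_le_sum_sqr v f 1 vb.1 fb.1.
  have h : commutes v f by move=> c; rewrite v4.
  move=> /(_ h)/(_ _)/(_ b).
  rewrite !mul1r ler_sqr ?nnegrE ?rnorm_ge0//; apply=> c.
  by rewrite v2 /= subrK mul1r.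
by move=> b; have := v2 b; rewrite /= => <-; exact: le_trans (vle _) (vle _).
Qed.

Lemma opos_sqr f : bsa f -> opos (f \o f).
Proof.
move=> fb; have [_ [k [k0 fk]]] := fb.
have h := @opos_sqr1 _ (bsa_comp_scale k^-1 fb) _.
exists (k ^+ 2); split; first exact: exprn_gt0.
move=> b; have -> : (k ^+ 2)%:C *: b - (f \o f) b =
  (k ^+ 2)%:C *: (b - k^-1%:C *: f (k^-1%:C *: f b)).
  rewrite /= (adj_scale fb.1); lmodule R B.
rewrite rnormZ ger0_norm ?sqr_ge0// ler_wpM2l ?sqr_ge0//; apply: h => c.
rewrite rnormZ gtr0_norm ?invr_gt0//.
by rewrite ler_pdivrMl.
Qed.

(** The quadratic term is kept because it outgrows the linear bound on powers in [near1_swap]. *)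
Lemma bernoulli2 (e : R) n : 0 <= e ->
  1 + n%:R * e + (n%:R * (n%:R - 1) / 2) * e ^+ 2 <= (1 + e) ^+ n.
Proof.
move=> e0; elim: n => [|n IH]; first by rewrite expr0; lra.
rewrite (exprS (1 + e)) -natr1.
have n0 : 0 <= n%:R * (n%:R - 1) / 2 * e ^+ 3 :> R.
  case: n {IH} => [|n]; first by rewrite !mul0r.
  rewrite -[X in _ * (X - _)]natr1 addrK; apply: mulr_ge0.
    by rewrite divr_ge0// mulr_ge0.
  exact: exprn_ge0.
have := ler_wpM2l (addr_ge0 ler01 e0) IH.
by move: (_ * _ ^+ n) n0 => y; lra.
Qed.

(* Powers of [1 + h h'] and [1 + h' h] are related by
   (1 + h h')^n = 1 + h (sum_(k < n) (1 + h' h)^k) h'. *)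
Lemma near1_swap h h' : adj h h' -> bounded h -> bounded h' ->
  (forall b, `‖b + h' (h b)‖ <= `‖b‖) -> forall b, `‖b + h (h' b)‖ <= `‖b‖.
Proof.
move=> hh' [k [k0 hk]] [k' [k'0 hk']] H.
have h'h := adj_sym hh'.
pose f b := b + h' (h b); pose g b := b + h (h' b).
(* [Q n] is the sum of the powers [f^k] with [k < n]. As [f] is a contraction, its norm grows at
   most linearly in [n]. *)
pose Q := fix Q n b := if n is m.+1 then b + f (Q m b) else 0.
have gE n b : iter n g b = b + h (Q n (h' b)).
  elim: n => [|n IH]; first by rewrite /= (adj_zero hh') addr0.
  rewrite iterS IH /g /= /f (adj_add h'h) !(adj_add hh').
  by lmodule R B.
have Qle n b : `‖Q n b‖ <= n%:R * `‖b‖.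
  elim: n => [|n IH]; first by rewrite /= rnorm0 mul0r.
  have := rnormD b (f (Q n b)); have := H (Q n b).
  by rewrite -/(f _) /= -natr1; lra.
have gsa : adj g g.
  by move=> b c; rewrite /g !ipE hh' h'h.
have itsa n b c : ip (iter n g b) c = ip b (iter n g c).
  by elim: n b c => //= n IH b c; rewrite gsa IH -iterSr.
move=> b; rewrite leNgt; apply/negP => lt.
have b0 : 0 < `‖b‖.
  rewrite lt_neqAle rnorm_ge0 andbT; apply/negP => /eqP/esym/rnorm_eq0 b0.
  by move: lt; rewrite b0 (adj_zero h'h) (adj_zero hh') addr0 ltxx.
pose r := `‖g b‖ / `‖b‖.
have r1 : 1 < r by rewrite ltr_pdivlMr// mul1r.
(* Self-adjointness gives [‖g^m b‖^2 <= ‖b‖ ‖g^(2m) b‖], so a ratio [r > 1] at the first power grows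
   geometrically along the powers of two. This contradicts the linear bound [up]. *)
have pow n : r ^+ (2 ^ n) * `‖b‖ <= `‖iter (2 ^ n) g b‖.
  elim: n => [|n IH]; first by rewrite expn0 expr1 /= divfK// gt_eqF.
  have := ip_norm b (iter (2 ^ n.+1) g b).
  rewrite expnS mul2n -addnn iterD -itsa rnorm_cstarM => le.
  rewrite -(ler_pM2l b0) (le_trans _ le)// exprD.
  have r0 : 0 <= r ^+ (2 ^ n) by rewrite exprn_ge0// ltW// (lt_trans _ r1).
  have -> : `‖b‖ * (r ^+ (2 ^ n) * r ^+ (2 ^ n) * `‖b‖) =
    (r ^+ (2 ^ n) * `‖b‖) ^+ 2 by ring.
  by rewrite ler_sqr ?nnegrE ?rnorm_ge0// mulr_ge0// ltW.
have up n : `‖iter n g b‖ <= (1 + k * k' * n%:R) * `‖b‖.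
  rewrite gE (le_trans (rnormD _ _))// mulrDl mul1r lerD2l.
  apply: (le_trans (hk _)); rewrite -!mulrA ler_pM2l// mulrCA.
  apply: (le_trans (Qle _ _)); rewrite ler_wpM2l//.
have key n : r ^+ (2 ^ n) <= 1 + k * k' * (2 ^ n)%:R.
  by rewrite -(ler_pM2r b0); exact: le_trans (pow n) (up _).
pose e := r - 1.
have e0 : 0 < e by rewrite subr_gt0.
have binom n : 1 + n%:R * e + (n%:R * (n%:R - 1) / 2) * e ^+ 2 <= r ^+ n.
  have -> : r = 1 + e by rewrite /e; lra.
  exact/bernoulli2/ltW.
have /(_ (Num.truncn (2 * k * k' / e ^+ 2 + 2)))[N HN] : forall M, exists n, (M < 2 ^ n)%N.
  by move=> M; exists M; exact: ltn_expl.
have kk0 : 0 < k * k' by exact: mulr_gt0.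
have := le_trans (binom (2 ^ N)%N) (key N).
have : 2 * k * k' / e ^+ 2 + 2 < (2 ^ N)%:R.
  rewrite -(ler_nat R) in HN; apply: lt_le_trans HN.
  exact: truncnS_gt.
move: (_%:R : R) => x xlt.
have e2 : 0 < e ^+ 2 by exact: exprn_gt0.
have : 2 * k * k' < (x - 2) * e ^+ 2.
  by rewrite -ltr_pdivrMr//; lra.
have x2 : 2 < x.
  by apply: le_lt_trans xlt; rewrite lerDr divr_ge0 ?mulr_ge0 ?ltW.
move: (e ^+ 2) e2 => y y0 h1 h2.
have : x * (2 * k * k') < x * ((x - 2) * y) by rewrite ltr_pM2l//; lra.
have : 0 < x * y by rewrite mulr_gt0//; lra.
have : 0 < x * e by rewrite mulr_gt0//; lra.
lra.
Qed.

End CStar.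

(** * Kaplansky's theorem and the norm of a sum of positive elements *)

Section CStarPositivity.
Context (R : realType) (B : cstarAlgType R).
Implicit Types (a b c d x y : B) (f g h : B -> B).

Local Notation "a ** b" := (cmul a b) (at level 40, left associativity).

Lemma boundedP f (k : R) : (forall b, `‖f b‖ <= k * `‖b‖) -> bounded f.
Proof.
move=> fk; exists (`|k| + 1); split; first by rewrite ltr_wpDl.
move=> b; apply: (le_trans (fk b)); rewrite ler_wpM2r ?rnorm_ge0//.
by have := ler_norm k; lra.
Qed.

Lemma boundedZ f (k : R[i]) : bounded f -> bounded (fun b => k *: f b).
Proof.
move=> [c [c0 fc]]; apply: (@boundedP _ (complex.Re `|k| * c)) => b.
have -> : `‖k *: f b‖ = complex.Re `|k| * `‖f b‖.
  by rewrite /rnorm normrZ -/(rnorm (f b)) rnormE normc_def /= mulr0 subr0.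
by rewrite -mulrA ler_wpM2l// normc_def /= sqrtr_ge0.
Qed.

Lemma boundedD f g : bounded f -> bounded g -> bounded (fun b => f b + g b).
Proof.
move=> [c [c0 fc]] [k [k0 gk]]; apply: (@boundedP _ (c + k)) => b.
by rewrite mulrDl (le_trans (rnormD _ _))// lerD.
Qed.

Lemma bounded_comp f g : bounded f -> bounded g -> bounded (f \o g).
Proof.
move=> [c [c0 fc]] [k [k0 gk]]; apply: (@boundedP _ (c * k)) => b /=.
by apply: (le_trans (fc _)); rewrite -mulrA ler_wpM2l// ltW.
Qed.

Lemma eq_opos f g : f =1 g -> opos f -> opos g.
Proof. by move=> fg [t [t0 ft]]; exists t; split=> // b; rewrite -fg. Qed.

(** The roots [v] of [f / t] and [v'] of [- f / t] commute and satisfy [v^2 + v'^2 = 0], so [v = 0]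
    by [sqr_le_sum_sqr] with constant 0. *)
Lemma opos_eq0 f : bsa f -> opos f -> opos (fun b => - f b) -> forall b, f b = 0.
Proof.
move=> fb [t1 [t10 h1]] [t2 [t20 h2]].
pose t := t1 + t2; have t0 : 0 < t by exact: addr_gt0.
have t1t : t1 <= t by rewrite lerDl ltW.
have t2t : t2 <= t by rewrite lerDr ltW.
have {}h1 := opos_large h1 t1t.
have {}h2 := opos_large h2 t2t.
have scale g : (forall b, `‖t%:C *: b - g b‖ <= t * `‖b‖) ->
    forall b, `‖b - t^-1%:C *: g b‖ <= `‖b‖.
  move=> gt b; rewrite -(ler_pM2l t0) (le_trans _ (gt b))//.
  rewrite -{1}(gtr0_norm t0) -rnormZ le_eqVlt; apply/orP; left; apply/eqP.
  congr rnorm; lmodule R B.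
have [|v [vb v2 _ vC]] := sqrt_near1 (bsa_comp_scale t^-1 fb) _.
  exact: scale.
have [|v' [v'b v'2 _ v'C]] := sqrt_near1 (bsa_comp_scale (- t^-1) fb) _.
  move=> b; have := scale _ h2 b.
  suff -> : t^-1%:C *: - f b = (- t^-1)%:C *: f b by [].
  by lmodule R B.
have fE b : f b = - (t%:C *: v' (v' b)).
  by rewrite v'2; lmodule R B.
have v'f : commutes v' f.
  by move=> b; rewrite !fE (adj_opp v'b.1) (adj_scale v'b.1).
have vv' : commutes v v'.
  move=> b; rewrite -vC// => c; rewrite (adj_scale v'b.1) v'f//.
have v0 b : v b = 0.
  apply/rnorm_eq0/eqP; rewrite -sqrf_eq0; apply/eqP/le_anti.
  rewrite sqr_ge0 andbT.
  have := @sqr_le_sum_sqr _ _ v v' 0 vb.1 v'b.1 vv' _ b.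
  rewrite mul0r; apply=> c; rewrite v2 v'2 mul0r.
  have -> : t^-1%:C *: f c + (- t^-1)%:C *: f c = 0 by lmodule R B.
  by rewrite rnorm0.
move=> b; have := v2 b; rewrite v0 => /esym h.
have -> : f b = t%:C *: (t^-1%:C *: f b) by lmodule R B.
by rewrite h scaler0.
Qed.

(** Scaling [h] and [h'] by [t^(-1/2)] reduces this to [near1_swap]. It takes the place of the
    equality of the nonzero spectra of [h' h] and [h h']. *)
Lemma opos_swap h h' : adj h h' -> bounded h -> bounded h' ->
  opos (fun b => - h' (h b)) -> opos (fun b => - h (h' b)).
Proof.
move=> hh' bh bh' [t [t0 ht]].
have h'h := adj_sym hh'.
pose r := Num.sqrt t^-1.
have r2 : r * r * t = 1.
  by rewrite -expr2 sqr_sqrtr ?invr_ge0 ?mulVf ?gt_eqF// ltW.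
exists t; split=> // b.
have -> : t%:C *: b - - h (h' b) = t%:C *: (b + r%:C *: h (r%:C *: h' b)).
  have e : h (h' b) = (t * (r * r))%:C *: h (h' b).
    by rewrite mulrC r2 rmorph1 scale1r.
  by rewrite (adj_scale hh') [X in _ - - X]e; lmodule R B.
rewrite rnormZ gtr0_norm// ler_pM2l//.
apply: (@near1_swap _ _ (fun b => r%:C *: h b) (fun b => r%:C *: h' b)) => [c d|||c].
- by rewrite !ipE hh'; lmodule R B.
- exact: boundedZ.
- exact: boundedZ.
rewrite -(ler_pM2l t0) (le_trans _ (ht c))//.
rewrite -{1}(gtr0_norm t0) -rnormZ le_eqVlt; apply/orP; left; apply/eqP.
congr rnorm.
have e : h' (h c) = (t * (r * r))%:C *: h' (h c).
  by rewrite mulrC r2 rmorph1 scale1r.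
by rewrite (adj_scale h'h) [X in _ - - X]e; lmodule R B.
Qed.

(* Kaplansky: with [x = k' k], [u = |x|] and [m = u - x], the operator [k m]
   has square modulus [m x m = - u m^2 <= 0]; hence so has its adjoint, while
   the sum of the two square moduli is positive. So [k m = 0] and [x = u]. *)
Lemma opos_adj k k' : adj k k' -> bounded k -> bounded k' ->
  opos (fun b => k' (k b)).
Proof.
move=> kk' [c [c0 kc]] bk'; have [d [d0 k'd]] := bk'.
have k'k := adj_sym kk'.
pose e := (c * d)^-1; have e0 : 0 < e by rewrite invr_gt0 mulr_gt0.
pose x b := e%:C *: k' (k b).
have xb : bsa x.
  split=> [a b|]; first by rewrite /x !ipE k'k kk'; lmodule R B.
  by apply: boundedZ; apply: (bounded_comp bk'); exists c.
have xle b : `‖x b‖ <= `‖b‖.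
  rewrite rnormZ gtr0_norm// ler_pdivrMl ?mulr_gt0//.
  by rewrite (le_trans (k'd _))// [c * d]mulrC -mulrA ler_pM2l.
suff [t [t0 tx]] : opos x.
  have := oposZ (mulr_gt0 c0 d0) (ex_intro _ t (conj t0 tx)).
  by apply: eq_opos => b; rewrite /x /e; lmodule R B; rewrite ?gt_eqF.
have xx : bsa (x \o x) by exact: bsa_comp.
have [u [ub u2 u1 uC]] := sqrt_near1 xx (opos_sqr1 xb xle).
have xu : commutes x u by apply: uC.
(* The root [y] of [u] exhibits [u m^2] as the square of the self-adjoint operator [y m], hence as
   positive. *)
have [y [yb y2 _ yC]] := sqrt_near1 ub u1.
have mb : bsa (fun b => u b - x b).
  have [h1 h2] := bsaD ub (bsa_comp_scale (-1) xb).
  have e1 b : u b - x b = u b + (-1)%:C *: x b by lmodule R B.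
  split=> [a b|]; first by rewrite !e1 h1.
  by case: h2 => j [j0 hj]; exists j; split=> // b; rewrite e1 hj.
pose m b := u b - x b; rewrite -/m in mb.
have um : commutes u m by move=> b; rewrite /m (adj_add ub.1) (adj_opp ub.1) xu.
have ym : commutes y m.
  by move=> b; rewrite -yC// => a; rewrite um.
have xm b : x (m b) = - u (m b).
  by rewrite /m !(adj_add xb.1, adj_opp xb.1, adj_add ub.1, adj_opp ub.1) u2 /=
    xu; lmodule R B.
have qb : bsa (y \o m) by exact: bsa_comp.
pose h b := k (m b).
pose g b := m (k' b).
have hg : adj h g by move=> a b; rewrite /h kk' mb.1.
have bh : bounded h by apply: bounded_comp mb.2; exists c.
have bg : bounded g by apply: bounded_comp bk'; exact: mb.2.
have ghE b : g (h b) = - (e^-1%:C *: (y \o m) ((y \o m) b)).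
  rewrite /g /h; have -> : k' (k (m b)) = e^-1%:C *: x (m b).
    by rewrite /x; lmodule R B.
  rewrite (adj_scale mb.1) xm (adj_opp mb.1) /= (ym (y (m b))) y2.
  by lmodule R B.
have gh_neg : opos (fun b => - g (h b)).
  have := oposZ _ (opos_sqr qb); move=> /(_ e^-1); rewrite invr_gt0 => /(_ e0).
  by apply: eq_opos => b; rewrite ghE opprK.
have gh := adj_sym hg.
have xmE b : x (m b) = e%:C *: k' (h b) by [].
clearbody g h.
have hg_neg := opos_swap hg bh bg gh_neg.
have hg_pos : opos (fun b => h (g b)).
  (* These are twice the real and imaginary parts of [h], and [(p^2 + q^2) / 2 = h g + g h]. Adding
     the positive operator [- g h] leaves [h g]. *)
  pose p b := h b + g b; pose q b := 'i *: (g b - h b).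
  have pb : bsa p.
    split=> [a b|]; last exact: boundedD.
    by rewrite /p !ipE hg gh addrC.
  have qqb : bsa q.
    split=> [a b|]; first by rewrite /q !ipE hg gh; lmodule R B.
    have /boundedZ H := boundedD bg (boundedZ (-1) bh).
    have [j [j0 hj]] := H 'i; exists j; split=> // b.
    by rewrite /q; have := hj b; rewrite scaleN1r.
  have half0 : 0 < 2^-1 :> R by rewrite invr_gt0.
  have := oposD (oposD (oposZ half0 (opos_sqr pb)) (oposZ half0 (opos_sqr qqb)))
    gh_neg.
  apply: eq_opos => b.
  rewrite /p /q /= !(adj_add hg, adj_add gh, adj_scale hg, adj_scale gh,
     adj_opp hg, adj_opp gh).
  by lmodule R B.
have hgb : bsa (fun b => h (g b)).
  by split=> [a b|]; [rewrite hg gh | exact: bounded_comp].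
have hg0 := opos_eq0 hgb hg_pos hg_neg.
have g0 b : g b = 0.
  apply/rnorm_eq0/eqP; rewrite -sqrf_eq0 -rnorm_cstarM -/(ip _ _) gh hg0.
  by rewrite /ip cmul0r rnorm0.
have h0 b : h b = 0.
  by apply: ip_inj => a; rewrite -gh g0 /ip cstar0 cmul0l cmul0r.
have xm0 b : x (m b) = 0 by rewrite xmE h0 (adj_zero k'k) scaler0.
have m0 b : m b = 0.
  apply/rnorm_eq0/eqP; rewrite -sqrf_eq0 -rnorm_cstarM -/(ip _ _) mb.1.
  have -> : m (m b) = 0.
    have := xm b; rewrite xm0 => /esym/eqP; rewrite oppr_eq0 => /eqP um0.
    by rewrite {1}/m um0 xm0 subrr.
  by rewrite /ip cmul0r rnorm0.
(* Now [x = u], and the square root [u] was built with [1 - u] a contraction, so [t = 1] serves. *)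
exists 1; split=> // b; rewrite mul1r rmorph1 scale1r.
by have := m0 b; rewrite /m => /eqP; rewrite subr_eq0 => /eqP <-.
Qed.

(** Positivity is expressed through left multiplication by [y]. In this form it is visibly stable
    under sums, unlike the form [c^* c]; the passage from [c^* c] is Kaplansky's theorem. *)
Definition pos y := cstar y = y /\ opos (fun b => y ** b).

Lemma lmul_adj a : adj (fun b => a ** b) (fun b => cstar a ** b).
Proof. by move=> b c; rewrite /ip cstarM cmulA. Qed.

Lemma lmul_bounded a : bounded (fun b => a ** b).
Proof. by apply: (@boundedP _ `‖a‖) => b; exact: rnormM. Qed.

Lemma pos_cstarM a : pos (cstar a ** a).
Proof.
split; first by rewrite cstarM cstarK.
have := opos_adj (lmul_adj a) (lmul_bounded _) (lmul_bounded _).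
by apply: eq_opos => b; rewrite cmulA.
Qed.

Lemma posD x y : pos x -> pos y -> pos (x + y).
Proof.
move=> [xs xp] [ys yp]; split; first by rewrite cstarD xs ys.
by apply: (eq_opos _ (oposD xp yp)) => b; rewrite cmulDl.
Qed.

Lemma posZ (k : R) y : 0 <= k -> pos y -> pos (k%:C *: y).
Proof.
rewrite le_eqVlt => /orP[/eqP <- _|k0 [ys yp]].
  rewrite rmorph0 scale0r; split; first exact: cstar0.
  exists 1; split=> // b; rewrite cmul0l subr0 rmorph1 scale1r mul1r//.
split; first by rewrite cstarZ ys; lmodule R B.
by apply: (eq_opos _ (oposZ k0 yp)) => b; rewrite cmulZl.
Qed.

(** Left multiplication by [y] is [t v^2] with [v] self-adjoint. Hence multiplication by [a y a^*]
    is [t k' k], where [k = v a^*] and [k' = a v] are adjoint, and [opos_adj] applies. *)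
Lemma pos_conj a y : pos y -> pos (a ** y ** cstar a).
Proof.
move=> [ys [t [t0 yt]]]; split; first by rewrite !cstarM cstarK ys cmulA.
have yb : bsa (fun b => y ** b).
  by split; [rewrite -{2}ys; exact: lmul_adj | exact: lmul_bounded].
have [|v [vb v2 _ _]] := sqrt_near1 (bsa_comp_scale t^-1 yb) _.
  move=> b; rewrite -(ler_pM2l t0) (le_trans _ (yt b))//.
  rewrite -{1}(gtr0_norm t0) -rnormZ le_eqVlt; apply/orP; left; apply/eqP.
  by congr rnorm; lmodule R B.
have h1 : adj (fun b => v (cstar a ** b)) (fun b => a ** v b).
  by move=> b c; rewrite vb.1 lmul_adj cstarK.
have := opos_adj h1 (bounded_comp vb.2 (lmul_bounded _))
  (bounded_comp (lmul_bounded _) vb.2).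
move=> /(oposZ t0); apply: eq_opos => b /=.
rewrite v2 cmulZr !cmulA; lmodule R B.
Qed.

(** With [r = ‖a‖] and [v^2 = 1 - a^2 / r^2], a combination of the squares [a^2] and [v^2] equals
    [(s - y) + (a^2 + y)], of norm at most [s + ‖a^2 + y‖]. Dropping [v^2] by [sqr_le_sum_sqr] and
    evaluating at the vector [a] gives the claim. *)
Lemma sqr_norm_le_pos_sa a y : cstar a = a -> pos y ->
  `‖a‖ ^+ 2 <= `‖a ** a + y‖.
Proof.
move=> asa [ys [s [s0 ys0]]].
have := rnorm_ge0 a; rewrite le_eqVlt => /orP[/eqP <-|a0].
  by rewrite expr0n rnorm_ge0.
pose r := `‖a‖.
have ab : bsa (fun b => a ** b).
  by split; [rewrite -{2}asa; exact: lmul_adj | exact: lmul_bounded].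
have [v [vb v2 _ vC]] : exists v, [/\ bsa v,
    forall b, v (v b) = b - (r^-1 ^+ 2)%:C *: (a ** (a ** b)),
    forall b, `‖b - v b‖ <= `‖b‖
    & forall g, bsa g -> commutes g (fun b => (r^-1 ^+ 2)%:C *: (a ** (a ** b))) ->
       commutes g v].
  apply: sqrt_compl => [b c|b].
    by rewrite !ipE !ab.1; lmodule R B.
  rewrite rnormZ ger0_norm ?sqr_ge0// exprVn ler_pdivrMl ?exprn_gt0//.
  rewrite (le_trans (rnormM _ _))// expr2 -mulrA ler_pM2l//.
  exact: rnormM.
(* The weights are chosen so that [p^2 a^2 + q^2 v^2 = s + a^2], while
   [‖p a a‖^2 = (s + r^2) r^2]. *)
pose p := Num.sqrt (s + r ^+ 2) * r^-1; pose q := Num.sqrt s.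
have p2 : p * p = (s + r ^+ 2) * (r^-1 ^+ 2).
  rewrite mulrACA -!expr2 sqr_sqrtr// addr_ge0 ?sqr_ge0//; exact: ltW.
have q2 : q * q = s by rewrite -expr2 sqr_sqrtr// ltW.
have := @sqr_le_sum_sqr _ _ (fun b => p%:C *: (a ** b)) (fun b => q%:C *: v b)
  (s + `‖a ** a + y‖) (bsa_comp_scale p ab).1 (bsa_comp_scale q vb).1 _ _ a.
have -> : `‖p%:C *: (a ** a)‖ ^+ 2 = (s + r ^+ 2) * r ^+ 2.
  rewrite rnormZ -{1}asa rnorm_cstarM exprMn real_normK ?num_real// expr2 p2.
  by rewrite -/r; field; exact: lt0r_neq0.
rewrite ler_pM2r ?exprn_gt0// lerD2l; apply=> b.
  rewrite (adj_scale vb.1) cmulZr vC//; first by lmodule R B.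
  by move=> d; rewrite cmulZr.
have -> : p%:C *: (a ** (p%:C *: (a ** b))) + q%:C *: v (q%:C *: v b) =
    (s%:C *: b - y ** b) + (a ** a + y) ** b.
  rewrite (adj_scale vb.1) cmulZr v2 !scalerA -!rmorphM p2 q2 cmulDl -cmulA.
  by lmodule R B; exact: lt0r_neq0.
rewrite mulrDl (le_trans (rnormD _ _))// lerD//.
exact: rnormM.
Qed.

(** The self-adjoint case for [a a^*] and [a y a^*] gives [‖a‖^4 <= ‖a (a^* a + y) a^*‖ <= ‖a‖^2
    ‖a^* a + y‖]. *)
Lemma sqr_norm_le_pos a y : pos y -> `‖a‖ ^+ 2 <= `‖cstar a ** a + y‖.
Proof.
move=> yp; have := rnorm_ge0 a; rewrite le_eqVlt => /orP[/eqP <-|a0].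
  by rewrite expr0n rnorm_ge0.
have aas : cstar (a ** cstar a) = a ** cstar a by rewrite cstarM cstarK.
have := sqr_norm_le_pos_sa aas (pos_conj a yp).
have -> : `‖a ** cstar a‖ = `‖a‖ ^+ 2.
  by have := rnorm_cstarM (cstar a); rewrite cstarK rnorm_star.
have -> : a ** cstar a ** (a ** cstar a) + a ** y ** cstar a =
    a ** (cstar a ** a + y) ** cstar a.
  by rewrite cmulDr cmulDl !cmulA.
have := rnormM (a ** (cstar a ** a + y)) (cstar a).
have := rnormM a (cstar a ** a + y); rewrite rnorm_star.
move: (`‖a ** (_ + _)‖) (`‖_ ** cstar a‖) (`‖_ + y‖) => z w v h1 h2 h3.
have h4 : `‖a‖ ^+ 2 * `‖a‖ ^+ 2 <= `‖a‖ ^+ 2 * v.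
  rewrite -expr2 (le_trans h3)// (le_trans h2)//.
  by rewrite expr2 mulrAC ler_pM2r.
by rewrite ler_pM2l ?exprn_gt0 in h4.
Qed.

End CStarPositivity.

(** * Hilbert modules and symmetric operators *)

Section HilbertModuleTheory.
Context (R : realType) (B : cstarAlgType R) (E : hilbertModType B).
Implicit Types (x y z : E).

Lemma innerDl x y z : inner (x + y) z = inner x z + inner y z.
Proof. by rewrite -inner_star innerDr cstarD !inner_star. Qed.
Lemma innerZl k x y : inner (k *: x) y = k^* *: inner x y.
Proof. by rewrite -inner_star innerZr cstarZ inner_star. Qed.
Lemma innerNr x y : inner x (- y) = - inner x y.
Proof. by rewrite -scaleN1r innerZr scaleN1r. Qed.
Lemma innerNl x y : inner (- x) y = - inner x y.
Proof. by rewrite -inner_star innerNr cstarN inner_star. Qed.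
Definition innerE :=
  (innerDl, @innerDr R B E, innerNl, innerNr, innerZl, @innerZr R B E).

Lemma rnorm_inner x : `‖inner x x‖ = `‖x‖ ^+ 2.
Proof. by have := norm_inner x; rewrite !rnormE -rmorphXn => /complexI. Qed.

Lemma inner_rnorm_eq x y : inner x x = inner y y -> `‖x‖ = `‖y‖.
Proof.
move=> e; apply/eqP; rewrite -(eqrXn2 (ltn0Sn 1)) ?rnorm_ge0//.
by rewrite -!rnorm_inner e.
Qed.

Lemma inner0r x : inner x 0 = 0.
Proof. by have := innerZr 0 x 0; rewrite !scale0r. Qed.
Lemma inner0l x : inner 0 x = 0.
Proof. by rewrite -inner_star inner0r cstar0. Qed.

(* The constant 4 results from polarization and the triangle inequality. *)
Lemma inner_le x y : `‖inner x y‖ <= 4 * (`‖x‖ * `‖y‖).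
Proof.
have sq (u v : E) : `‖inner u v‖ <= (`‖u‖ + `‖v‖) ^+ 2.
  have h (w : E) : `‖w‖ <= `‖u‖ + `‖v‖ -> `‖inner w w‖ <= (`‖u‖ + `‖v‖) ^+ 2.
    by move=> le; rewrite rnorm_inner ler_sqr ?nnegrE ?addr_ge0 ?rnorm_ge0.
  have e : (4 : R)%:C *: inner u v =
      (inner (u + v) (u + v) - inner (u - v) (u - v)) +
      'i *: (inner (u - 'i *: v) (u - 'i *: v) - inner (u + 'i *: v) (u + 'i *: v)).
    by rewrite !innerE; lmodule R B.
  rewrite -(ler_pM2l (_ : 0 < 4 :> R))// -{1}(ger0_norm (_ : 0 <= 4 :> R))//.
  rewrite -rnormZ e.
  have := rnormD (inner (u + v) (u + v) - inner (u - v) (u - v))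
    ('i *: (inner (u - 'i *: v) (u - 'i *: v) - inner (u + 'i *: v) (u + 'i *: v))).
  rewrite rnormZi.
  have := rnormB (inner (u + v) (u + v)) (inner (u - v) (u - v)).
  have := rnormB (inner (u - 'i *: v) (u - 'i *: v)) (inner (u + 'i *: v) (u + 'i *: v)).
  have := h _ (rnormD u v); have := h _ (rnormB u v).
  have := rnormD u ('i *: v); have := rnormB u ('i *: v); rewrite rnormZi.
  by move=> /h h1 /h h2; lra.
have := rnorm_ge0 x; rewrite le_eqVlt => /orP[/eqP/esym/rnorm_eq0 ->|x0].
  by rewrite inner0l !rnorm0 mul0r mulr0.
have := rnorm_ge0 y; rewrite le_eqVlt => /orP[/eqP/esym/rnorm_eq0 ->|y0].
  by rewrite inner0r !rnorm0 !mulr0.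
have := sq (`‖x‖^-1%:C *: x) (`‖y‖^-1%:C *: y).
rewrite innerZr innerZl.
have -> : `‖y‖^-1%:C *: ((`‖x‖^-1%:C)^* *: inner x y) =
   (`‖x‖ * `‖y‖)^-1%:C *: inner x y by lmodule R B; apply/andP; split; exact: lt0r_neq0.
rewrite !rnormZ !gtr0_norm ?invr_gt0 ?mulr_gt0// !mulVf ?gt_eqF//.
rewrite ler_pdivrMl ?mulr_gt0//; lra.
Qed.

Lemma inner_inj x y : (forall z, inner z x = inner z y) -> x = y.
Proof.
move=> H; apply/eqP; rewrite -subr_eq0; apply/eqP/inner_eq0.
by rewrite innerDr innerNr H subrr.
Qed.

Lemma pos_inner x : pos (inner x x).
Proof. by have [c] := inner_ge0 x; rewrite subr0 => ->; exact: pos_cstarM. Qed.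

Lemma sqr_rnorm_le_inner x (y : B) : pos y -> `‖x‖ ^+ 2 <= `‖inner x x + y‖.
Proof.
have [c] := inner_ge0 x; rewrite subr0 => e yp.
rewrite -rnorm_inner e rnorm_cstarM; exact: sqr_norm_le_pos.
Qed.

End HilbertModuleTheory.

(** * Lipschitz perturbations of surjective maps *)

Section Perturbation.
Context (R : realType) (V : completeNormedModType R[i]).

(** A solution is a fixed point of [x -> A^-1 (y - P x)], a contraction with ratio [p / m]. The
    fixed point lies in [D] because it is a value of the right inverse [G]. *)
Lemma perturb_onto (D : set V) (A P : V -> V) (m p : R) : 0 <= p -> p < m ->
  (forall x y, D x -> D y -> m * `‖x - y‖ <= `‖A x - A y‖) ->
  (forall y, exists x, D x /\ A x = y) ->
  (forall x y, `‖P x - P y‖ <= p * `‖x - y‖) ->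
  forall y, exists x, D x /\ A x + P x = y.
Proof.
move=> p0 pm Alb Aonto Plip y.
have [G HG] := choice Aonto.
have m0 : 0 < m by exact: le_lt_trans pm.
pose T x := G (y - P x).
pose q := p / m.
have q0 : 0 <= q by rewrite divr_ge0// ltW.
have q1 : q < 1 by rewrite ltr_pdivrMr// mul1r.
have Tlip u v : `‖T u - T v‖ <= q * `‖u - v‖.
  have [Du Au] := HG (y - P u); have [Dv Av] := HG (y - P v).
  have := Alb _ _ Du Dv; rewrite -/(T u) -/(T v) in Au Av *.
  rewrite Au Av.
  have -> : y - P u - (y - P v) = - (P u - P v) by lmodule R V.
  rewrite rnormN => le.
  by rewrite /q mulrAC ler_pdivlMr// mulrC (le_trans le).
pose u n := iter n T 0.
pose c := `‖u 1%N - u 0%N‖.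
have step n : `‖u n.+1 - u n‖ <= c * q ^+ n.
  elim: n => [|n IH]; first by rewrite expr0 mulr1.
  apply: (le_trans (Tlip (u n.+1) (u n))).
  by rewrite exprS mulrCA ler_wpM2l.
have [|n|x ux] := @tends_summable _ _ u
   (fun n => c * (1 - q ^+ n) / (1 - q)) (c / (1 - q)).
- move=> n; rewrite -mulrBl -mulrBr (le_trans (step n))// le_eqVlt.
  apply/orP; left; apply/eqP; rewrite exprS; field.
  by rewrite subr_eq0 eq_sym lt_eqF.
- rewrite ler_pM2r ?invr_gt0 ?subr_gt0//.
  by rewrite ler_piMr ?rnorm_ge0// gerBl exprn_ge0.
have [Dx Ax] := HG (y - P x).
have e : x = T x.
  have h : tends (fun n => u n.+1) x.
    by move=> e e0; have [N HN] := ux e e0; exists N => n Nn; apply: HN; exact: leqW.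
  by apply: (tends_uniq h); apply: tends_lip ux => n; exact: Tlip.
by exists x; rewrite {1 2}e /T; split=> //; rewrite Ax subrK.
Qed.

End Perturbation.

(** * Symmetric operators, surjectivity of their shifts and self-adjointness *)

Section OperatorTheory.
Context (R : realType) (B : cstarAlgType R) (E : hilbertModType B).
Implicit Types (A : operator E) (x y : E).

Definition op_symmetric A :=
  forall x y, dom A x -> dom A y -> inner (A x) y = inner x (A y).

Definition seq_closed A := forall (u : nat -> E) x y, (forall n, dom A (u n)) ->
  tends u x -> tends (fun n => A (u n)) y -> dom A x /\ A x = y.

Definition onto_shift A (z : R[i]) :=
  forall y, exists x, dom A x /\ A x + z *: x = y.

Lemma domD A x y : dom A x -> dom A y -> dom A (x + y).
Proof. by case: (dom_submodule A) => _ + _ _; apply. Qed.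
Lemma domZ A k x : dom A x -> dom A (k *: x).
Proof. by case: (dom_submodule A) => _ _ + _; apply. Qed.
Lemma domN A x : dom A x -> dom A (- x).
Proof. by rewrite -scaleN1r; exact: domZ. Qed.
Lemma domB A x y : dom A x -> dom A y -> dom A (x - y).
Proof. by move=> Ax /domN; exact: domD. Qed.
Lemma opN A x : dom A x -> A (- x) = - A x.
Proof. by move=> Ax; rewrite -scaleN1r opZ// scaleN1r. Qed.
Lemma opB A x y : dom A x -> dom A y -> A (x - y) = A x - A y.
Proof. by move=> Ax Ay; rewrite opD ?opN//; exact: domN. Qed.

Lemma dense_approx (D : set E) x (e : R) :
  dense D -> 0 < e -> exists2 y, D y & `‖x - y‖ < e.
Proof.
move=> dD e0.
have [|y [/= xy Dy]] := dD (ball x e%:C) _ (ball_open _ _).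
  by exists x; apply: ballxx; rewrite ltcR.
by exists y => //; move: xy; rewrite -ball_normE /ball_/= rnormE ltcR.
Qed.

Lemma approx_dense (D : set E) :
  (forall x (e : R), 0 < e -> exists2 y, D y & `‖x - y‖ < e) -> dense D.
Proof.
move=> H O [x Ox] oO.
have /nbhs_ballP[e /= e0 He] : nbhs x O by exact: open_nbhs_nbhs.
have ere : e = (complex.Re e)%:C.
  by rewrite [LHS]complexE (ger0_Im (ltW e0)) mulr0 addr0.
move: e0 He; rewrite ere ltcR => /(H x)[y Dy xy] He; exists y; split=> //.
by apply: He; rewrite -ball_normE /ball_/= rnormE ltcR.
Qed.

Lemma tends_innerr x (u : nat -> E) y : tends u y ->
  tends (fun n => inner x (u n)) (inner x y).
Proof.
apply: (@tends_lip _ _ _ (fun y => inner x y) (4 * `‖x‖)) => n.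
by rewrite -innerNr -innerDr -mulrA; exact: inner_le.
Qed.

Lemma self_adjoint_symmetric A : self_adjoint A -> op_symmetric A.
Proof. by move=> [_ sa] x y Ax Ay; apply: (proj1 (sa y (A y))). Qed.

Lemma self_adjoint_closed A : self_adjoint A -> seq_closed A.
Proof.
move=> [_ sa] u x y Au ux uy; apply: (proj2 (sa x y)) => w Aw.
apply: (tends_uniq (tends_innerr _ ux)).
move=> e e0; have [N HN] := tends_innerr w uy e0.
exists N => n /HN; rewrite -(proj1 (sa (u n) (A (u n))))//.
Qed.

(** For [z = p + iq], both vectors have inner square [<(A + p) x, (A + p) x> + q^2 <x, x>]. The
    difference and the sum of the two vectors then yield the next two bounds by the triangle
    inequality alone. *)
Lemma symmetric_conj_norm A x (z : R[i]) : op_symmetric A -> dom A x ->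
  `‖A x + z *: x‖ = `‖A x + z^* *: x‖.
Proof.
move=> sA Ax; apply: inner_rnorm_eq; rewrite !innerE (sA x x)//.
by case: z => p q; lmodule R B.
Qed.

Lemma symmetric_shift_le A x (z : R[i]) : op_symmetric A -> dom A x ->
  `|complex.Im z| * `‖x‖ <= `‖A x + z *: x‖.
Proof.
move=> sA Ax; have := symmetric_conj_norm z sA Ax.
have := rnormB (A x + z *: x) (A x + z^* *: x).
have -> : A x + z *: x - (A x + z^* *: x) =
    ('i * (2 * complex.Im z)%:C) *: x by case: z => p q; lmodule R E.
by rewrite rnormZir normrM ger0_norm//; lra.
Qed.

Lemma symmetric_op_le A x (a : R) : op_symmetric A -> dom A x ->
  `‖A x‖ <= `‖A x + ('i * a%:C) *: x‖.
Proof.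
move=> sA Ax; have := symmetric_conj_norm ('i * a%:C) sA Ax.
have := rnormD (A x + ('i * a%:C) *: x) (A x + ('i * a%:C)^* *: x).
have -> : A x + ('i * a%:C) *: x + (A x + ('i * a%:C)^* *: x) =
    (2 : R)%:C *: A x by lmodule R E.
by rewrite rnormZ ger0_norm//; lra.
Qed.

Lemma onto_shift_near A (w z : R[i]) : op_symmetric A -> onto_shift A w ->
  complex.Re `|z - w| < `|complex.Im w| -> onto_shift A z.
Proof.
move=> sA Aw zw y.
have [|||x [Ax <-]] := @perturb_onto _ _ (dom A) (fun x => A x + w *: x)
  (fun x => (z - w) *: x) _ _ _ zw _ Aw _ y.
- by rewrite normc_def /= sqrtr_ge0.
- move=> u v Au Av; have := symmetric_shift_le w sA (domB Au Av).
  rewrite opB//; suff -> : A u - A v + w *: (u - v) =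
    A u + w *: u - (A v + w *: v) by [].
  by case: w {Aw zw} => p q; lmodule R E.
- by move=> u v; rewrite -scalerBr /rnorm normrZ -/(rnorm _) rnormE normc_def /= mulr0 subr0.
by exists x; split=> //; rewrite -addrA -scalerDl (addrC w) subrK.
Qed.

(** Surjectivity spreads from [w] to the disc of radius [|Im w|] around it. Moving vertically by
    half the current imaginary part multiplies that part by 3/2, and the growing discs exhaust the
    half-plane. *)
Lemma onto_shift_all A (w z : R[i]) : op_symmetric A -> onto_shift A w ->
  0 < complex.Im w * complex.Im z -> onto_shift A z.
Proof.
case: w z => a b [c d] sA Aw /= bd0.
have grow n : onto_shift A (a +i* (b * (3 / 2) ^+ n)).
  elim: n => [|n IH]; first by rewrite expr0 mulr1.
  apply: (onto_shift_near sA IH); rewrite normc_def /=.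
  rewrite subrr expr0n add0r sqrtr_sqr exprS.
  set p := b * _ ^+ n.
  have -> : b * (3 / 2 * (3 / 2) ^+ n) - p = p * 2^-1 by rewrite /p; field.
  have b0 : b != 0.
    by apply/eqP => b0; rewrite b0 mul0r ltxx in bd0.
  have c0 : 3 / 2 != 0 :> R by rewrite mulf_neq0 ?invr_eq0 ?pnatr_eq0.
  have p0 : p != 0 by exact: mulf_neq0 b0 (expf_neq0 n c0).
  rewrite -normr_gt0 in p0; rewrite normrM (ger0_norm (_ : 0 <= 2^-1)) ?invr_ge0//.
  lra.
(* With [t = (3 / 2)^n], this says that [c + id] lies in the disc around [a + ibt] of radius [|bt|]:
   [(c - a)^2 + (d - bt)^2 < (bt)^2]. *)
have [n Hn] : exists n, (c - a) ^+ 2 + d ^+ 2 < 2 * (b * d) * (3 / 2) ^+ n.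
  pose M := ((c - a) ^+ 2 + d ^+ 2) / (b * d).
  exists (Num.truncn M).+1.
  have := @bernoulli2 R (2^-1) (Num.truncn M).+1 (ltac:(by rewrite invr_ge0)).
  have -> : 1 + 2^-1 = 3 / 2 :> R by lra.
  have := truncnS_gt M; rewrite ltr_pdivrMr//.
  have n1 : 1 <= (Num.truncn M).+1%:R :> R by rewrite ler1n.
  move: ((3 / 2) ^+ _) => t.
  move: (_%:R : R) n1 => k k1 h1 h2.
  have kk : 0 <= k * (k - 1) by rewrite mulr_ge0//; lra.
  have : k * (b * d) <= 2 * t * (b * d) by rewrite ler_pM2r//; lra.
  lra.
apply: (onto_shift_near sA (grow n)); rewrite normc_def /=.
set t := (3 / 2) ^+ n in Hn *.
have -> : `|b * t| = Num.sqrt ((b * t) ^+ 2) by rewrite sqrtr_sqr.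
rewrite ltr_sqrt.
  by move: Hn; lra.
rewrite lt_neqAle sqr_ge0 andbT eq_sym sqrf_eq0 mulf_neq0//.
  by apply/eqP => b0; rewrite b0 mul0r ltxx in bd0.
by rewrite expf_neq0// mulf_neq0 ?invr_eq0 ?pnatr_eq0.
Qed.

(** The lower bound [|Im z| ‖x‖] makes preimages of a convergent sequence Cauchy, and closedness
    puts their limit in the domain. *)
Lemma onto_shift_dense A (z : R[i]) : op_symmetric A -> seq_closed A ->
  complex.Im z != 0 -> dense (range_shift A z) -> onto_shift A z.
Proof.
move=> sA cA z0 dA y.
have H n : exists x, dom A x /\ `‖y - (A x + z *: x)‖ < n.+1%:R^-1.
  have [|_ [x Ax <-] xy] := dense_approx y dA (_ : 0 < n.+1%:R^-1).
    by rewrite invr_gt0.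
  by exists x.
have [u Hu] := choice H.
have Au n : dom A (u n) by case: (Hu n).
have uy : tends (fun n => A (u n) + z *: u n) y.
  move=> e e0; exists (Num.truncn e^-1) => n Nn.
  rewrite rdistC; apply: (lt_trans (Hu n).2).
  rewrite invf_plt ?posrE// (lt_le_trans (truncnS_gt _))//.
  by rewrite ler_nat.
have uc : cauchy_seq u.
  move=> e e0; have e1 : 0 < `|complex.Im z| * e by rewrite mulr_gt0 ?normr_gt0.
  have [N HN] := tends_cauchy uy e1; exists N => m n Nm Nn.
  rewrite -(ltr_pM2l (_ : 0 < `|complex.Im z|)) ?normr_gt0//.
  apply: le_lt_trans (HN m n Nm Nn).
  apply: (le_trans (symmetric_shift_le z sA (domB (Au m) (Au n)))).
  rewrite opB// le_eqVlt; apply/orP; left; apply/eqP; congr rnorm.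
  by case: (z) => p q; lmodule R E.
have [x ux] := cauchy_seq_tends uc.
have zux : tends (fun n => - (z *: u n)) (- (z *: x)).
  apply: (@tends_lip _ _ _ (fun x => - (z *: x)) (complex.Re `|z|)) ux => n.
  rewrite -opprD rnormN -scalerBr /rnorm normrZ -/(rnorm _) rnormE.
  by rewrite normc_def /= mulr0 subr0.
have [|Ax e] := cA u x (y - z *: x) Au ux.
  have := tendsD uy zux; congr (tends _ _).
  by apply/funext => n; rewrite addrK.
by exists x; split=> //; rewrite e subrK.
Qed.

(** Regularity supplies the shifts [w] and [- w], one in each half-plane; the sign of [Im w * Im z]
    selects the one that reaches [z]. *)
Lemma regular_onto_shift A (z : R[i]) : self_adjoint A -> regular A ->
  complex.Im z != 0 -> onto_shift A z.
Proof.
move=> sA [w [w0 d1 d2]] z0.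
have symA := self_adjoint_symmetric sA; have cA := self_adjoint_closed sA.
have [neg|] := ltP (complex.Im w * complex.Im z) 0; last first.
  rewrite le_eqVlt eq_sym mulf_eq0 (negbTE w0) (negbTE z0)/= => pz.
  exact: onto_shift_all (onto_shift_dense symA cA w0 d1) pz.
have w0' : complex.Im (- w) != 0 by case: w w0 {d1 d2 neg} => a b; rewrite /= oppr_eq0.
apply: onto_shift_all (onto_shift_dense symA cA w0' d2) _ => //.
by case: w neg {w0 d1 d2 w0'} => a b /=; rewrite mulNr oppr_gt0.
Qed.

Lemma onto_shift_self_adjoint A : op_symmetric A -> dense (dom A) ->
  (forall z, complex.Im z != 0 -> onto_shift A z) -> self_adjoint A /\ regular A.
Proof.
move=> sA dA oA.
have i0 : complex.Im 'i != 0 :> R by rewrite /= oner_eq0.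
have Ni0 : complex.Im (- 'i) != 0 :> R by rewrite /= oppr_eq0 oner_eq0.
split; last first.
  exists 'i; split=> //; apply: approx_dense => x e e0.
    have [y [Ay <-]] := oA _ i0 x; exists (A y + 'i *: y); first by exists y.
    by rewrite subrr rnorm0.
  have [y [Ay <-]] := oA _ Ni0 x; exists (A y + - 'i *: y); first by exists y.
  by rewrite subrr rnorm0.
split=> // y z; split=> [[Ay <-] x Ax|H]; first exact: sA.
(* For [(y, z)] in the adjoint graph, [x] solves [(A + i) x = z + i y]. Then [y] and [x] have equal
   inner products with all of the range of [A - i], which is [E]. *)
have [x [Ax xe]] := oA _ i0 (z + 'i *: y).
suff yx : y = x by subst y; split=> //; move: xe => /addIr.
apply: inner_inj => w.
have [v [Av <-]] := oA _ Ni0 w.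
have : inner v (A x + 'i *: x) = inner v (z + 'i *: y) by rewrite xe.
rewrite !innerE -(sA _ _ Av Ax) -(H _ Av) => e.
have -> : inner (A v) y + (- 'i)^* *: inner v y = inner (A v) y + 'i *: inner v y.
  by lmodule R B.
by rewrite -e; lmodule R B.
Qed.

End OperatorTheory.

(** * Resolvents and Yosida approximations *)

Section Resolvent.
Context (R : realType) (B : cstarAlgType R) (E : hilbertModType B).
Context (S : operator E) (symS : op_symmetric S).
Context (ontoS : forall a : R, a != 0 -> onto_shift S ('i * a%:C)).
Implicit Types (x y z : E) (a b : R).

(** The resolvent [(S + ia)^-1] for real [a]. For nonzero [a] the default value 0 of [xget] is not
    reached, and [res_uniq] shows that the choice is forced. *)
Definition res a y : E := xget 0 [set x | dom S x /\ S x + ('i * a%:C) *: x = y].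

Lemma resP a y : a != 0 -> dom S (res a y) /\ S (res a y) + ('i * a%:C) *: res a y = y.
Proof. by move=> a0; have [x Hx] := ontoS a0 y; exact: (xgetPex (P := [set x | _]) 0 (ex_intro _ x Hx)). Qed.

Lemma dom_res a y : a != 0 -> dom S (res a y).
Proof. by move=> /(resP y)[]. Qed.

Lemma op_res a y : a != 0 -> S (res a y) = y - ('i * a%:C) *: res a y.
Proof. by move=> /(resP y)[_ {2}<-]; rewrite addrK. Qed.

Lemma shift_le a x : dom S x -> `|a| * `‖x‖ <= `‖S x + ('i * a%:C) *: x‖.
Proof.
move=> Sx; have := symmetric_shift_le ('i * a%:C) symS Sx.
by rewrite /= mul0r mul1r add0r.
Qed.

Lemma res_uniq a x y : a != 0 -> dom S x -> S x + ('i * a%:C) *: x = y ->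
  x = res a y.
Proof.
move=> a0 Sx xy; have [Sr ry] := resP y a0.
apply/eqP; rewrite -subr_eq0; apply/eqP/rnorm_eq0/eqP.
rewrite -[_ == _](mulrI_eq0 _ (lregP (_ : `|a| != 0))) ?normr_eq0//.
rewrite eq_le mulr_ge0 ?rnorm_ge0// andbT.
apply: (le_trans (shift_le _ (domB Sx Sr))); rewrite opB//.
have -> : S x - S (res a y) + ('i * a%:C) *: (x - res a y) =
  (S x + ('i * a%:C) *: x) - (S (res a y) + ('i * a%:C) *: res a y).
  by lmodule R E.
by rewrite xy ry subrr rnorm0.
Qed.

Lemma resD a x y : a != 0 -> res a (x + y) = res a x + res a y.
Proof.
move=> a0; have [Sx ex] := resP x a0; have [Sy ey] := resP y a0.
apply/esym/res_uniq => //; first exact: domD.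
by rewrite opD// -[in RHS]ex -[in RHS]ey; lmodule R E.
Qed.

Lemma resZ a (k : R[i]) x : a != 0 -> res a (k *: x) = k *: res a x.
Proof.
move=> a0; have [Sx ex] := resP x a0.
apply/esym/res_uniq => //; first exact: domZ.
by rewrite opZ// -[in RHS]ex scalerDr !scalerA [k * _]mulrC.
Qed.

Lemma resN a x : a != 0 -> res a (- x) = - res a x.
Proof. by move=> a0; rewrite -scaleN1r resZ// scaleN1r. Qed.

Lemma resB a x y : a != 0 -> res a (x - y) = res a x - res a y.
Proof. by move=> a0; rewrite resD// resN. Qed.

Lemma dom_op_res a x : a != 0 -> dom S x -> dom S (S (res a x)).
Proof.
by move=> a0 Sx; rewrite op_res//; apply: domB => //; apply/domZ/dom_res.
Qed.

Lemma res_op a x : a != 0 -> dom S x -> res a (S x) = S (res a x).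
Proof.
move=> a0 Sx; apply/esym/res_uniq => //; first exact: dom_op_res.
have Sr := dom_res x a0.
rewrite {1}op_res// opB ?opZ//; first by lmodule R E.
exact: domZ.
Qed.

Lemma res_comm a b x : a != 0 -> b != 0 -> res a (res b x) = res b (res a x).
Proof.
move=> a0 b0; apply/esym/res_uniq => //; first exact: dom_res.
by rewrite -(res_op b0 (dom_res x a0)) -resZ// -resD// (resP x a0).2.
Qed.

Lemma res_le a x : a != 0 -> `|a| * `‖res a x‖ <= `‖x‖.
Proof. by move=> a0; have [Sr {2}<-] := resP x a0; exact: shift_le. Qed.

Lemma op_res_le a x : a != 0 -> `‖S (res a x)‖ <= `‖x‖.
Proof. by move=> a0; have [Sr {2}<-] := resP x a0; exact: symmetric_op_le. Qed.

Lemma res_subr a x : a != 0 ->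
  res a x = S (res (- a) (res a x)) - ('i * a%:C) *: res (- a) (res a x).
Proof.
move=> a0; have Na0 : - a != 0 by rewrite oppr_eq0.
by rewrite {1}(op_res _ Na0); lmodule R E.
Qed.

(* The Cayley transform [(S - ia)(S + ia)^-1] is isometric. *)
Lemma op_res_conj_norm a x : a != 0 -> `‖S (res (- a) x)‖ = `‖S (res a x)‖.
Proof.
move=> a0; have Na0 : - a != 0 by rewrite oppr_eq0.
(* With [g = (S^2 + a^2)^-1 x], the two vectors are [(S - ia) S g] and [(S + ia) S g], which
   [symmetric_conj_norm] compares. *)
set g := res (- a) (res a x).
have Sg : dom S g by exact: dom_res.
have SSg : dom S (S g) by apply: dom_op_res => //; exact: dom_res.
have e1 : S (res a x) = S (S g) + (- ('i * a%:C)) *: S g.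
  rewrite {1}(res_subr _ a0) -/g opB ?opZ//; first by lmodule R E.
  exact: domZ.
have e2 : S (res (- a) x) = S (S g) + (- ('i * a%:C))^* *: S g.
  rewrite {1}(res_subr _ Na0) opprK [res a _]res_comm// -/g opB ?opZ//.
    by lmodule R E.
  exact: domZ.
by rewrite e1 e2 -symmetric_conj_norm.
Qed.

Definition yosida a x := ('i * a%:C) *: S (res a x).

Lemma yosidaE a x : a != 0 ->
  yosida a x = ('i * a%:C) *: x + (a ^+ 2)%:C *: res a x.
Proof. by move=> a0; rewrite /yosida op_res//; lmodule R E. Qed.

Lemma yosida_norm a x : `‖yosida a x‖ = `|a| * `‖S (res a x)‖.
Proof. by rewrite /yosida rnormZir. Qed.

Lemma yosida_normN a x : a != 0 -> `‖yosida (- a) x‖ = `‖yosida a x‖.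
Proof. by move=> a0; rewrite !yosida_norm normrN op_res_conj_norm. Qed.

Lemma yosidaB a x y : a != 0 -> yosida a (x - y) = yosida a x - yosida a y.
Proof. by move=> a0; rewrite !yosidaE// resB//; lmodule R E. Qed.

Lemma yosida_le a x : a != 0 -> `‖yosida a x‖ <= `|a| * `‖x‖.
Proof. by move=> a0; rewrite yosida_norm ler_wpM2l// op_res_le. Qed.

Lemma yosida_adj a x y : a != 0 -> inner (yosida a x) y = inner x (yosida (- a) y).
Proof.
move=> a0; have Na0 : - a != 0 by rewrite oppr_eq0.
have [Sx ex] := resP x a0; have [Sy ey] := resP y Na0.
rewrite /yosida -{2}ex -{1}ey !innerE (symS Sx Sy).
by lmodule R B.
Qed.

(* The operator [G = a^2 (S^2 + a^2)^-1]. *)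
Definition smooth a x := (a ^+ 2)%:C *: res a (res (- a) x).

Lemma dom_smooth a x : a != 0 -> dom S (smooth a x).
Proof. by move=> a0; apply/domZ/dom_res. Qed.

Lemma smoothD a x y : a != 0 -> smooth a (x + y) = smooth a x + smooth a y.
Proof. by move=> a0; rewrite /smooth !resD ?oppr_eq0// scalerDr. Qed.

Lemma smoothZ a k x : a != 0 -> smooth a (k *: x) = k *: smooth a x.
Proof. by move=> a0; rewrite /smooth !resZ ?oppr_eq0//; lmodule R E. Qed.

Lemma smooth_le a x : a != 0 -> `‖smooth a x‖ <= `‖x‖.
Proof.
move=> a0; have Na0 : - a != 0 by rewrite oppr_eq0.
rewrite /smooth rnormZ normrX expr2 -mulrA.
have := res_le (res (- a) x) a0; have := res_le x Na0; rewrite normrN.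
move=> h1 h2; apply: le_trans h1; rewrite ler_wpM2l//.
Qed.

(** Thus [S G] is the real part of [Y_a], since [Y_(-a)] is the adjoint of [Y_a]. This is how [T] is
    later moved past [S G]. *)
Lemma op_smooth a x : a != 0 ->
  S (smooth a x) = (2^-1)%:C *: (yosida a x + yosida (- a) x).
Proof.
move=> a0; have Na0 : - a != 0 by rewrite oppr_eq0.
have Sr := dom_res (res (- a) x) a0.
rewrite /smooth opZ// /yosida.
have e : res (- a) x = res a x + (2 * a)%:C *: ('i *: res a (res (- a) x)).
  rewrite {1}(res_subr _ Na0) opprK [in RHS](res_subr x a0) [res (- a) (res a x)]res_comm//.
  by lmodule R E.
have h1 := domZ 'i Sr; have h2 := domZ (2 * a)%:C h1; have h3 := dom_res x a0.
rewrite [X in ('i * (- a)%:C) *: S X]e opD// opZ// opZ//.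
by lmodule R E.
Qed.

Lemma smooth_op a x : a != 0 -> dom S x -> smooth a (S x) = S (smooth a x).
Proof.
move=> a0 Sx; have Na0 : - a != 0 by rewrite oppr_eq0.
rewrite /smooth (res_op Na0 Sx) (res_op a0 (dom_res x Na0)) opZ//.
exact: dom_res.
Qed.

Lemma smooth_res a b x : a != 0 -> b != 0 -> smooth a (res b x) = res b (smooth a x).
Proof.
move=> a0 b0; have Na0 : - a != 0 by rewrite oppr_eq0.
by rewrite /smooth resZ// [res (- a) _]res_comm// [res a (res b _)]res_comm.
Qed.

Lemma yosida_op_smooth a x : a != 0 ->
  S (smooth a (yosida a x)) = yosida a (S (smooth a x)).
Proof.
move=> a0; rewrite /yosida smoothZ// -[S (smooth a x)]/(S (smooth a x)).
have Sr := dom_res x a0.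
rewrite smooth_op// smooth_res// opZ//; last first.
  by apply: dom_op_res => //; exact: dom_smooth.
by rewrite res_op//; exact: dom_smooth.
Qed.

(** [G - 1 = - S (S^2 + a^2)^-1 S] on [dom S], and [S (S^2 + a^2)^-1 = (S + ia)^-1 (1 + ia (S -
    ia)^-1)] has norm at most [2 / |a|]. *)
Lemma smooth_approx a y : a != 0 -> dom S y ->
  `|a| * `‖smooth a y - y‖ <= 2 * `‖S y‖.
Proof.
move=> a0 Sy; have Na0 : - a != 0 by rewrite oppr_eq0.
have -> : smooth a y - y = - (res a (S y) + ('i * a%:C) *: res a (res (- a) (S y))).
  have e : res (- a) (S y) = y + ('i * a%:C) *: res (- a) y.
    by rewrite res_op// op_res//; lmodule R E.
  rewrite e resD// resZ// res_op// op_res// /smooth.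
  by lmodule R E.
rewrite rnormN.
have := rnormD (res a (S y)) (('i * a%:C) *: res a (res (- a) (S y))).
rewrite rnormZir.
have := res_le (S y) a0; have := res_le (S y) Na0; rewrite normrN.
have := res_le (res (- a) (S y)) a0.
have : 0 < `|a| by rewrite normr_gt0.
move: (`|a|) => n n0 h1 h2 h3 h4.
have : n * `‖res a (S y) + ('i * a%:C) *: res a (res (- a) (S y))‖ <=
  n * (`‖res a (S y)‖ + n * `‖res a (res (- a) (S y))‖) by rewrite ler_pM2l.
have : n * (n * `‖res a (res (- a) (S y))‖) <= n * `‖res (- a) (S y)‖ by rewrite ler_pM2l.
lra.
Qed.

(** On smoothed vectors, [S - Y_a = S (1 - ia (S + ia)^-1) = S^2 (S + ia)^-1 = (ia)^-1 Y_a S]. *)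
Lemma op_smooth_yosida a x : a != 0 ->
  S (smooth a x) - smooth a (yosida a x) = (- ('i * (a^-1)%:C)) *: yosida a (S (smooth a x)).
Proof.
move=> a0; have Sr := dom_res x a0; have Sg := dom_smooth x a0.
have Srg := dom_res (smooth a x) a0.
have e : S (res a (S (smooth a x))) =
    S (smooth a x) - ('i * a%:C) *: S (res a (smooth a x)).
  have h := domZ ('i * a%:C) Srg.
  by rewrite res_op// [X in S X]op_res// opB// (opZ _ Srg).
rewrite /yosida e smoothZ// smooth_op// smooth_res//.
by lmodule R E.
Qed.

End Resolvent.

(** * Weakly anticommuting operators *)

Section AntiCommutingEstimates.
Context (R : realType) (B : cstarAlgType R) (E : hilbertModType B).
Implicit Types (x y z : E) (a : R).

(** The common core of the bounds for [Y_a + s T + i mu] and for [S + T + i mu]: [p] is [Y_a x] or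
    [S x], [q] is [T x], and [w] is the anticommutation error. Positive summands are dropped one at
    a time by [sqr_rnorm_le_inner]; a large [mu] absorbs the error. *)
Lemma anticomm_lower_bound (K mu th s : R) (x p q w z : E) :
  1 <= K -> 48 * K <= mu -> 0 <= th -> `|s| <= 1 ->
  inner z z = (1 + th)%:C *: inner p p + inner q q + (mu ^+ 2)%:C *: inner x x
    + s%:C *: inner x w ->
  `‖w‖ <= 2 * K * (`‖x‖ + `‖p‖ + `‖q‖) ->
  [/\ `‖p‖ <= 2 * `‖z‖, `‖q‖ <= 2 * `‖z‖ & mu * `‖x‖ <= 2 * `‖z‖].
Proof.
move=> K1 muK th0 s1 e wle.
have mu0 : 0 < mu by lra.
pose Q := `‖inner z z - s%:C *: inner x w‖.
have pp := posZ th0 (pos_inner p).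
have xx := posZ (sqr_ge0 mu) (pos_inner x).
have Qp : `‖p‖ ^+ 2 <= Q.
  have := sqr_rnorm_le_inner p (posD pp (posD (pos_inner q) xx)).
  by rewrite /Q e; congr (_ <= rnorm _); lmodule R B.
have Qq : `‖q‖ ^+ 2 <= Q.
  have := sqr_rnorm_le_inner q (posD (posD pp (pos_inner p)) xx).
  by rewrite /Q e; congr (_ <= rnorm _); lmodule R B.
have Qx : (mu * `‖x‖) ^+ 2 <= Q.
  have := sqr_rnorm_le_inner (mu%:C *: x) (posD (posD pp (pos_inner p)) (pos_inner q)).
  rewrite rnormZ (gtr0_norm mu0) /Q e !innerE; congr (_ <= rnorm _).
  by lmodule R B.
have QA : Q <= `‖z‖ ^+ 2 + 8 * K * (`‖x‖ * (`‖x‖ + `‖p‖ + `‖q‖)).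
  rewrite /Q (le_trans (rnormB _ _))// rnorm_inner rnormZ lerD2l.
  have := inner_le x w; have := rnorm_ge0 (inner x w); have := rnorm_ge0 x.
  move=> x0 i0 ile.
  have : `‖x‖ * `‖w‖ <= `‖x‖ * (2 * K * (`‖x‖ + `‖p‖ + `‖q‖)) by rewrite ler_wpM2l.
  have : `|s| * `‖inner x w‖ <= 1 * `‖inner x w‖ by rewrite ler_wpM2r.
  lra.
have z0 := rnorm_ge0 z; have x0 := rnorm_ge0 x.
have p0 := rnorm_ge0 p; have q0 := rnorm_ge0 q.
move: Q Qp Qq Qx QA => Q Qp Qq Qx QA.
move: (`‖z‖) (`‖x‖) (`‖p‖) (`‖q‖) z0 x0 p0 q0 Qp Qq Qx QA => n t u v n0 t0 u0 v0 Qu Qv Qt QA.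
have mt : t <= mu * t by rewrite ler_peMl//; lra.
(* The 8 is 4 from [inner_le] times 2 from the bound on [w]. With [m = mu t], [m (m + u + v) <= 2
   m^2 + (u^2 + v^2) / 2 <= 3 Q], so 48 makes the error at most [Q / 2]. *)
have h : 8 * K * (t * (t + u + v)) <= Q / 2.
  have h1 : 48 * K * (t * (t + u + v)) <= mu * (t * (t + u + v)).
    by rewrite ler_wpM2r// mulr_ge0// !addr_ge0.
  have h2 : mu * (t * (t + u + v)) <= (mu * t) * (mu * t + u + v).
    by rewrite mulrA ler_wpM2l ?mulr_ge0 ?(ltW mu0)//; lra.
  have := sqr_ge0 (mu * t - u); have := sqr_ge0 (mu * t - v).
  by move: (mu * t) Qt h2 => m; lra.
have Qn : Q <= (2 * n) ^+ 2 by have := sqr_ge0 n; lra.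
have n2 : 0 <= 2 * n by rewrite mulr_ge0.
by split; rewrite -ler_sqr ?nnegrE ?mulr_ge0 ?(ltW mu0)//; lra.
Qed.

Context (S T : operator E) (symS : op_symmetric S) (symT : op_symmetric T).
Context (cS : seq_closed S) (cT : seq_closed T).
Context (SO : forall a : R, a != 0 -> onto_shift S ('i * a%:C)).
Context (TO : forall a : R, a != 0 -> onto_shift T ('i * a%:C)).
Context (K a0 : R) (K1 : 1 <= K) (a0K : 2 * K <= a0).
Context (anticomm_le : forall x, common_dom S T x ->
  `‖anticomm S T x‖ <= K * (`‖x‖ + `‖S x‖ + `‖T x‖)).
Context (res_common : forall a x, a0 <= `|a| -> dom S x ->
  dom T (S x + ('i * a%:C) *: x) -> common_dom S T x).

Local Notation k := (anticomm S T).
Local Notation res := (res S).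
Local Notation yosida := (yosida S).
Local Notation smooth := (smooth S).

Lemma a_neq0 a : a0 <= `|a| -> a != 0.
Proof. by move=> aa; rewrite -normr_gt0; have := K1; have := a0K; lra. Qed.

Lemma common_res a y : a0 <= `|a| -> dom T y -> common_dom S T (res a y).
Proof.
move=> aa Ty; have [Sr ry] := resP SO y (a_neq0 aa).
by apply: (res_common aa Sr); rewrite ry.
Qed.

(** With [r = (S + ia)^-1 y], one has [(S - ia) T r = k r - T (S + ia) r = k r - T y]. *)
Lemma op_res_anticomm a y : a0 <= `|a| -> dom T y ->
  T (res a y) = res (- a) (k (res a y) - T y).
Proof.
move=> aa Ty; have an0 := a_neq0 aa.
have [Sr Tr TSr STr] := common_res aa Ty.
apply: (res_uniq symS SO) => //; first by rewrite oppr_eq0.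
rewrite /anticomm (op_res SO _ an0) opB ?opZ//; first by lmodule R E.
exact: domZ.
Qed.

(** The hypothesis on [k] bounds the left side by [K (‖y‖ + ‖Y_a y‖ + |a| ‖T r‖)] with
    [r = (S + ia)^-1 y], and [|a| ‖T r‖ <= ‖k r‖ + ‖T y‖]. As [2 K <= |a|], the term [K ‖k r‖] is at
    most half of the left side. *)
Lemma anticomm_res_le a y : a0 <= `|a| -> dom T y ->
  `|a| * `‖k (res a y)‖ <= 2 * K * (`‖y‖ + `‖yosida a y‖ + `‖T y‖).
Proof.
move=> aa Ty; have an0 := a_neq0 aa; have Nan0 : - a != 0 by rewrite oppr_eq0.
have := anticomm_le (common_res aa Ty).
have := res_le symS SO (k (res a y) - T y) Nan0.
rewrite -op_res_anticomm// normrN.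
have := rnormB (k (res a y)) (T y).
have := res_le symS SO y an0; rewrite yosida_norm.
have := a0K; have := K1.
have := rnorm_ge0 (k (res a y)).
move: (`‖k _‖) (`‖k _ - _‖) (`‖T (res _ _)‖) (`‖S _‖) (`‖T y‖) (`‖y‖) (`‖res _ _‖) => kr kt tr sr ty y' r.
move: aa; move: (`|a|) => n aa k0 hK haK h1 h2 h3 h4.
have h5 : n * kr <= K * (n * r + n * sr + n * tr).
  rewrite -!mulrDr mulrCA ler_wpM2l//; lra.
have h6 : K * (n * r + n * sr + n * tr) <= K * (y' + n * sr + (kr + ty)).
  by rewrite ler_wpM2l//; lra.
have : 2 * K * kr <= n * kr by rewrite ler_wpM2r//; lra.
lra.
Qed.

Definition yosida_comm a x := (a ^+ 2)%:C *: res (- a) (k (res a x)).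

Lemma dom_yosida a x : a0 <= `|a| -> dom T x -> dom T (yosida a x).
Proof.
move=> aa Tx; have an0 := a_neq0 aa; have [_ Tr _ _] := common_res aa Tx.
by rewrite (yosidaE SO)//; apply: domD; exact: domZ.
Qed.

Lemma op_yosida a x : a0 <= `|a| -> dom T x ->
  T (yosida a x) = - yosida (- a) (T x) + yosida_comm a x.
Proof.
move=> aa Tx; have an0 := a_neq0 aa; have Nan0 : - a != 0 by rewrite oppr_eq0.
have [_ Tr _ _] := common_res aa Tx.
rewrite !(yosidaE SO)// opD ?opZ//; try exact: domZ.
rewrite op_res_anticomm// (resB symS SO)// /yosida_comm; lmodule R E.
Qed.

Lemma yosida_comm_le a x : a0 <= `|a| -> dom T x ->
  `‖yosida_comm a x‖ <= 2 * K * (`‖x‖ + `‖yosida a x‖ + `‖T x‖).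
Proof.
move=> aa Tx; have an0 := a_neq0 aa; have Nan0 : - a != 0 by rewrite oppr_eq0.
rewrite (le_trans _ (anticomm_res_le aa Tx))// rnormZ normrX expr2 -mulrA.
rewrite ler_wpM2l//; have := res_le symS SO (k (res a x)) Nan0.
by rewrite normrN.
Qed.

(* The imaginary part of the Yosida approximation is positive, so it does not
   spoil the lower bound. *)
Lemma yosida_sum_le a mu s x : a0 <= a -> 48 * K <= mu -> `|s| = 1 -> dom T x ->
  let z := yosida a x + s%:C *: T x + ('i * mu%:C) *: x in
  [/\ `‖yosida a x‖ <= 2 * `‖z‖, `‖T x‖ <= 2 * `‖z‖ & mu * `‖x‖ <= 2 * `‖z‖].
Proof.
move=> aa muK s1 Tx z.
have a_gt0 : 0 < a by have := K1; have := a0K; lra.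
have aa' : a0 <= `|a| by rewrite gtr0_norm.
have an0 := a_neq0 aa'; have Nan0 : - a != 0 by rewrite oppr_eq0.
have s2 : s * s = 1 by rewrite -expr2 -real_normK ?num_real// s1 expr1n.
have mu0 : 0 < mu by have := K1; lra.
have th0 : 0 <= 2 * mu / a by rewrite divr_ge0 ?mulr_ge0// ltW.
apply: (@anticomm_lower_bound K mu (2 * mu / a) s x _ (T x) (yosida_comm a x)) => //.
  by rewrite s1.
  have e1 : inner (yosida a x) (T x) = inner x (yosida (- a) (T x)) by exact: yosida_adj.
  have e2 : inner (T x) (yosida a x) = inner x (T (yosida a x)).
    by apply: symT => //; exact: dom_yosida.
  have e3 : inner (T x) x = inner x (T x) by exact: symT.
  have [Sr ex] := resP SO x an0.
  (* This says that the imaginary part of [Y_a] is [a^-1 Y_a^* Y_a]. Its cross term with [i mu]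
     gives the extra coefficient [2 mu / a] of [<Y_a x, Y_a x>]. *)
  have e4 : inner (yosida a x) x - inner x (yosida a x) =
     (- ('i * (2 / a)%:C)) *: inner (yosida a x) (yosida a x).
    rewrite /yosida -{2 3}ex !innerE (symS Sr Sr); lmodule R B.
  have e5 : inner x (yosida a x) = inner (yosida a x) x +
     ('i * (2 / a)%:C) *: inner (yosida a x) (yosida a x).
    have -> : inner x (yosida a x) = inner (yosida a x) x -
      (inner (yosida a x) x - inner x (yosida a x)) by lmodule R B.
    by rewrite e4; lmodule R B.
  have e6 : inner (T x) (T x) = (s * s)%:C *: inner (T x) (T x).
    by rewrite s2 rmorph1 scale1r.
  rewrite op_yosida// in e2; rewrite [X in _ + X + _ + _]e6 /z.
  move: (yosida a x) (yosida (- a) (T x)) (yosida_comm a x) e1 e2 e5 {e4 z}.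
  move=> Y Y' N e1 e2 e5; rewrite !innerE e1 e2 e3 e5 !innerE.
  lmodule R B.
exact: yosida_comm_le.
Qed.

Lemma sum_le mu x : 48 * K <= mu -> common_dom S T x ->
  let z := S x + T x + ('i * mu%:C) *: x in
  [/\ `‖S x‖ <= 2 * `‖z‖, `‖T x‖ <= 2 * `‖z‖ & mu * `‖x‖ <= 2 * `‖z‖].
Proof.
move=> muK Fx z; have [Sx Tx TSx STx] := Fx.
apply: (@anticomm_lower_bound K mu 0 1 x _ _ (k x)) => //; first by rewrite normr1.
  rewrite /z /anticomm !innerE -(symS Sx STx) -(symT Tx TSx).
  rewrite (symS Sx Sx) (symT Tx Tx).
  by lmodule R B.
have := anticomm_le Fx; have := K1; have := rnorm_ge0 x.
have := rnorm_ge0 (S x); have := rnorm_ge0 (T x) => t0 s0 x0 k1 h.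
have : 0 <= K * (`‖x‖ + `‖S x‖ + `‖T x‖) by rewrite mulr_ge0 ?addr_ge0//; lra.
lra.
Qed.


(** For [mu >= 2 a] the operator [Y_a], of norm at most [a], is a small perturbation of [T + i mu].
    Smaller [mu] are reached by descending in unit steps: the lower bound [(mu + 1) / 2] at [mu + 1]
    exceeds 1. *)
Lemma yosida_sum_onto a mu : a0 <= a -> 48 * K <= mu ->
  forall y, exists x, dom T x /\ yosida a x + T x + ('i * mu%:C) *: x = y.
Proof.
move=> aa muK; have K1' := K1.
have a_gt0 : 0 < a by have := a0K; lra.
have aa' : a0 <= `|a| by rewrite gtr0_norm.
have an0 := a_neq0 aa'.
have descent n : forall mu, 48 * K <= mu -> 2 * a - n%:R <= mu ->
    forall y, exists x, dom T x /\ yosida a x + T x + ('i * mu%:C) *: x = y.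
  elim: n => [|n IH] {muK}mu muK mun y.
    have mu0 : 0 < mu by lra.
    have [|||x [Tx <-]] := @perturb_onto _ _ (dom T)
      (fun x => T x + ('i * mu%:C) *: x) (yosida a) mu a (ltW a_gt0) _ _
      (TO (lt0r_neq0 mu0)) _ y.
    - by rewrite subr0 in mun; lra.
    - move=> u v Tu Tv; have := shift_le symT mu (domB Tu Tv).
      rewrite gtr0_norm// opB//; congr (_ <= rnorm _); lmodule R E.
    - move=> u v; rewrite -(yosidaB symS SO)//.
      by have := yosida_le symS SO (u - v) an0; rewrite gtr0_norm.
    by exists x; split=> //; rewrite -addrA addrC.
  have mu0 : 0 < mu + 1 by lra.
  have muK1 : 48 * K <= mu + 1 by lra.
  have [|||||x [Tx <-]] := @perturb_onto _ _ (dom T)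
    (fun x => yosida a x + T x + ('i * (mu + 1)%:C) *: x)
    (fun x => (- 'i) *: x) ((mu + 1) / 2) 1 _ _ _ _ _ y.
  - by [].
  - by lra.
  - move=> u v Tu Tv.
    have [_ _] := yosida_sum_le aa muK1 (normr1 _) (domB Tu Tv).
    rewrite (yosidaB symS SO)// opB// rmorph1 scale1r.
    have -> : yosida a u - yosida a v + (T u - T v) + ('i * (mu + 1)%:C) *: (u - v)
      = yosida a u + T u + ('i * (mu + 1)%:C) *: u -
        (yosida a v + T v + ('i * (mu + 1)%:C) *: v) by lmodule R E.
    lra.
  - by apply: IH => //; rewrite -natr1 in mun; lra.
  - move=> u v; have -> : - 'i *: u - - 'i *: v = - ('i *: (u - v)) by lmodule R E.
    by rewrite rnormN rnormZi mul1r.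
  by exists x; split=> //; lmodule R E.
have h : 2 * a - (Num.truncn (2 * a)).+1%:R <= mu.
  by have := truncnS_gt (2 * a); lra.
exact: descent muK h.
Qed.

(** * The regularization [G] and its commutator with [T] *)

Lemma smooth_common a x : a0 <= `|a| -> dom T x -> common_dom S T (smooth a x).
Proof.
move=> aa Tx.
have Naa : a0 <= `|- a| by rewrite normrN.
have [_ Tr _ _] := common_res Naa Tx.
have [Sg Tg TSg STg] := common_res aa Tr.
by split; rewrite /smooth ?opZ//; exact: domZ.
Qed.

(** [G] maps [dom T] into the common domain, is a contraction, and tends to the identity on the
    dense set [dom S]. The four distances from [x] to [t], [v], [G v] and [G t] in turn are each
    within [e / 4]. *)
Lemma dense_common (dS : dense (dom S)) (dT : dense (dom T)) :
  dense (common_dom S T).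
Proof.
apply: approx_dense => x e e0; have K1' := K1; have a0K' := a0K.
have e4 : 0 < e / 4 by rewrite divr_gt0.
have [t Tt xt] := dense_approx x dT e4.
have [v Sv tv] := dense_approx t dS e4.
pose a := Num.max a0 (8 * `‖S v‖ / e).
have aa : a0 <= a by rewrite le_max lexx.
have ae : 8 * `‖S v‖ <= a * e by rewrite -ler_pdivrMr// le_max lexx orbT.
have a_gt0 : 0 < a by lra.
have aa' : a0 <= `|a| by rewrite gtr0_norm.
have an0 := a_neq0 aa'.
exists (smooth a t); first exact: smooth_common.
have h1 : `‖smooth a v - v‖ <= e / 4.
  rewrite -(ler_pM2l a_gt0) -{1}(gtr0_norm a_gt0).
  by apply: (le_trans (smooth_approx symS SO an0 Sv)); lra.
have h2 := smooth_le symS SO (t - v) an0.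
rewrite (smoothD symS SO)// -(scaleN1r v) (smoothZ symS SO)// scaleN1r in h2.
rewrite scaleN1r in h2.
have := rdist_trans x t (smooth a t); have := rdist_trans t v (smooth a t).
have := rdist_trans v (smooth a v) (smooth a t).
by rewrite (rdistC v (smooth a v)) (rdistC (smooth a v) (smooth a t)); lra.
Qed.

(** The commutator of [T] with [G]: passing two resolvents changes the sign twice and leaves one
    anticommutator term for each. *)
Definition smooth_comm a x : E :=
  (a ^+ 2)%:C *: res (- a) (k (res a (res (- a) x)))
  - (a ^+ 2)%:C *: res (- a) (res a (k (res (- a) x))).

Lemma op_smooth_anticomm a x : a0 <= `|a| -> dom T x ->
  T (smooth a x) = smooth a (T x) + smooth_comm a x.
Proof.
move=> aa Tx; have an0 := a_neq0 aa; have Nan0 : - a != 0 by rewrite oppr_eq0.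
have Naa : a0 <= `|- a| by rewrite normrN.
have [_ Tr _ _] := common_res Naa Tx.
have [Sg Tg TSg STg] := common_res aa Tr.
rewrite [in LHS]/smooth opZ// op_res_anticomm// (op_res_anticomm Naa)// opprK.
rewrite !(resB symS SO)// /smooth /smooth_comm (res_comm symS SO (T x) an0 Nan0).
by lmodule R E.
Qed.

(** For [z = (S - ia)^-1 x], the vectors [z], [Y_a z] and [T z] are all [O(1/a)]. This gains the
    factor [1/a] over [anticomm_res_le]. *)
Lemma smooth_comm_le a x : a0 <= a -> dom T x ->
  a * `‖smooth_comm a x‖ <=
  2 * K * (2 + 2 * K) * (`‖x‖ + `‖yosida a x‖ + `‖T x‖).
Proof.
move=> aa Tx; have K1' := K1; have a0K' := a0K.
have a_gt0 : 0 < a by lra.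
have aa' : a0 <= `|a| by rewrite gtr0_norm.
have Naa : a0 <= `|- a| by rewrite normrN.
have an0 := a_neq0 aa'; have Nan0 : - a != 0 by rewrite oppr_eq0.
set z := res (- a) x.
have [_ Tz _ _] := common_res Naa Tx.
have := anticomm_res_le aa' Tz; have := anticomm_res_le Naa Tx.
rewrite (yosida_normN symS SO)// -/z normrN gtr0_norm//.
have zle : a * `‖z‖ <= `‖x‖.
  by have := res_le symS SO x Nan0; rewrite normrN gtr0_norm.
have Yzle : a * `‖yosida a z‖ <= `‖yosida a x‖.
  rewrite yosida_norm (yosida_norm _ a x) /z (res_comm symS SO)//.
  rewrite -(res_op symS SO)//; last exact: dom_res.
  rewrite gtr0_norm// ler_pM2l//.
  by have := res_le symS SO (S (res a x)) Nan0; rewrite normrN gtr0_norm.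
have Tzle : a * `‖T z‖ <= `‖k z‖ + `‖T x‖.
  have := res_le symS SO (k z - T x) an0; rewrite gtr0_norm//.
  rewrite {2}/z (op_res_anticomm Naa)// opprK -/z => h.
  exact: le_trans h (rnormB _ _).
have h1 : `‖(a ^+ 2)%:C *: res (- a) (k (res a z))‖ <= a * `‖k (res a z)‖.
  rewrite rnormZ normrX gtr0_norm// expr2 -mulrA ler_pM2l//.
  by have := res_le symS SO (k (res a z)) Nan0; rewrite normrN gtr0_norm.
have h2 : `‖(a ^+ 2)%:C *: res (- a) (res a (k z))‖ <= `‖k z‖.
  rewrite (res_comm symS SO)//; exact: (smooth_le symS SO).
have := rnormB ((a ^+ 2)%:C *: res (- a) (k (res a z)))
  ((a ^+ 2)%:C *: res (- a) (res a (k z))).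
rewrite -/(smooth_comm a x).
have := rnorm_ge0 (k z); have := rnorm_ge0 x.
have := rnorm_ge0 (yosida a x); have := rnorm_ge0 (T x).
have a1 : 1 <= a by lra.
move: (`‖_ *: res (- a) (k _)‖) (`‖_ *: res (- a) (res a _)‖) h1 h2 => e1 e2.
move: (`‖k (res a z)‖) (`‖k z‖) zle Yzle Tzle => k1 k2.
move: (`‖T z‖) (`‖yosida a z‖) (`‖z‖) => tz yz z'.
move: (`‖smooth_comm a x‖) (`‖yosida a x‖) (`‖T x‖) (`‖x‖) => c y t x'.
move=> h1 h2 h3 h4 h5 t0 y0 x0 k20 ce kz kr.
have ak2 : k2 <= a * k2 by rewrite ler_peMl.
have b1 : a * k1 * a <= 2 * K * (x' + y + (k2 + t)).
  have : a * (a * k1) <= a * (2 * K * (z' + yz + tz)) by rewrite ler_pM2l.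
  have : 2 * K * (a * z' + a * yz + a * tz) <= 2 * K * (x' + y + (k2 + t)).
    by rewrite ler_wpM2l//; lra.
  lra.
have b2 : 2 * K * k2 <= 2 * K * (2 * K * (x' + y + t)).
  by rewrite ler_wpM2l//; lra.
have b3 : a * c <= a * (e1 + e2) by rewrite ler_pM2l.
have b4 : a * e1 <= a * (a * k1) by rewrite ler_pM2l.
have b5 : a * e2 <= a * k2 by rewrite ler_pM2l.
have b6 : 0 <= K * (x' + y + t) by rewrite mulr_ge0 ?addr_ge0//; lra.
lra.
Qed.

(* Proved by applying [S G] to the equation for [x], which turns [T] into [- T]. *)
Lemma yosida_op_smooth_le a mu x y : a0 <= a -> 48 * K <= mu -> dom T x ->
  dom S y -> yosida a x + T x + ('i * mu%:C) *: x = y ->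
  `‖yosida a (S (smooth a x))‖ <=
  2 * `‖S y‖ + 4 * K * (`‖x‖ + `‖yosida a x‖ + `‖T x‖).
Proof.
move=> aa muK Tx Sy xy; have K1' := K1; have a0K' := a0K.
have a_gt0 : 0 < a by lra.
have aa' : a0 <= `|a| by rewrite gtr0_norm.
have Naa : a0 <= `|- a| by rewrite normrN.
have an0 := a_neq0 aa'; have Nan0 : - a != 0 by rewrite oppr_eq0.
set h := S (smooth a x).
have hE : h = (2^-1)%:C *: (yosida a x + yosida (- a) x).
  exact: (op_smooth symS SO).
have [_ _ Th _] := smooth_common aa' Tx.
have TY := dom_yosida aa' Tx; have TNY := dom_yosida Naa Tx.
have ThE : T h = - S (smooth a (T x)) +
    (2^-1)%:C *: (yosida_comm a x + yosida_comm (- a) x).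
  rewrite hE opZ ?opD//; last exact: domD.
  rewrite !op_yosida// opprK (op_smooth symS SO)//; lmodule R E.
(* By [ThE], moving [T] past [S G] costs a sign and a bounded error, so [h = S G x] solves the
   equation of [Y_a - T + i mu]; the lower bound is used with [s = -1]. *)
have eq : yosida a h + (-1)%:C *: T h + ('i * mu%:C) *: h =
    smooth a (S y) - (2^-1)%:C *: (yosida_comm a x + yosida_comm (- a) x).
  rewrite (smooth_op symS SO)// -xy !(smoothD symS SO)//.
  rewrite (smoothZ symS SO ('i * mu%:C) x an0).
  have SG z := dom_smooth SO z an0.
  have g1 := domZ ('i * mu%:C) (SG x); have g2 := domD (SG (yosida a x)) (SG (T x)).
  rewrite (opD g2 g1) (opD (SG _) (SG _)) (opZ _ (SG _)).
  by rewrite (yosida_op_smooth symS SO)// -/h ThE; lmodule R E.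
have s1 : `|-1 : R| = 1 by rewrite normrN normr1.
have [le _ _] := yosida_sum_le aa muK s1 Th; rewrite eq in le.
have := rnormB (smooth a (S y))
  ((2^-1)%:C *: (yosida_comm a x + yosida_comm (- a) x)).
rewrite (rnormZ 2^-1) ger0_norm ?invr_ge0//.
have := rnormD (yosida_comm a x) (yosida_comm (- a) x).
have := yosida_comm_le aa' Tx; have := yosida_comm_le Naa Tx.
rewrite (yosida_normN symS SO)//.
have := smooth_le symS SO (S y) an0.
lra.
Qed.

Lemma sum_dense_range mu y (e : R) : 48 * K <= mu -> dom S y -> 0 < e ->
  exists2 w, common_dom S T w & `‖S w + T w + ('i * mu%:C) *: w - y‖ < e.
Proof.
move=> muK Sy e0; have K1' := K1; have a0K' := a0K.
(* The defect of [w = G x] has three parts, bounded by [C1 / a], [2 ‖S y‖ / a] and [C2 / a]. The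
   factor 6 sums the three bounds by [2 ‖y‖] on [x], [Y_a x] and [T x]. *)
pose C1 := 2 * `‖S y‖ + 4 * K * (6 * `‖y‖).
pose C2 := 2 * K * (2 + 2 * K) * (6 * `‖y‖).
pose C := C1 + 2 * `‖S y‖ + C2.
have C0 : 0 <= C.
  have := rnorm_ge0 y; have := rnorm_ge0 (S y) => Sy0 y0.
  have h1 : 0 <= K * `‖y‖ by rewrite mulr_ge0//; lra.
  have h2 : 0 <= K * (K * `‖y‖) by rewrite mulr_ge0//; lra.
  rewrite /C /C1 /C2; lra.
pose a := Num.max a0 ((C + 1) / e).
have aa : a0 <= a by rewrite le_max lexx.
have ae : C + 1 <= a * e by rewrite -ler_pdivrMr// le_max lexx orbT.
have a_gt0 : 0 < a by lra.
have aa' : a0 <= `|a| by rewrite gtr0_norm.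
have an0 := a_neq0 aa'.
have [x [Tx xy]] := yosida_sum_onto aa muK y.
have Fw := smooth_common aa' Tx; exists (smooth a x) => //.
have [b1 b2 b3] := yosida_sum_le aa muK (normr1 _) Tx.
rewrite rmorph1 scale1r xy in b1 b2 b3.
have xle : `‖x‖ <= 2 * `‖y‖.
  by apply: le_trans b3; rewrite ler_peMl ?rnorm_ge0//; lra.
have c1 := yosida_op_smooth_le aa muK Tx Sy xy.
have c2 := smooth_comm_le aa Tx.
have c3 := smooth_approx symS SO an0 Sy; rewrite (gtr0_norm a_gt0) in c3.
have total : `‖x‖ + `‖yosida a x‖ + `‖T x‖ <= 6 * `‖y‖ by lra.
have d1 : `‖yosida a (S (smooth a x))‖ <= C1.
  apply: (le_trans c1); rewrite lerD2l ler_wpM2l//; lra.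
have d2 : a * `‖smooth_comm a x‖ <= C2.
  apply: (le_trans c2); rewrite ler_wpM2l// mulr_ge0//; lra.
have -> : S (smooth a x) + T (smooth a x) + ('i * mu%:C) *: smooth a x - y =
   (S (smooth a x) - smooth a (yosida a x)) + (smooth a y - y) + smooth_comm a x.
  rewrite op_smooth_anticomm// -{2}xy !(smoothD symS SO)//.
  rewrite (smoothZ symS SO ('i * mu%:C) x an0).
  by lmodule R E.
rewrite (op_smooth_yosida symS SO)//.
rewrite -(ltr_pM2l a_gt0).
have := rnormD ((- ('i * (a^-1)%:C)) *: yosida a (S (smooth a x)) + (smooth a y - y))
  (smooth_comm a x).
have := rnormD ((- ('i * (a^-1)%:C)) *: yosida a (S (smooth a x))) (smooth a y - y).
rewrite scaleNr rnormN (rnormZir a^-1) gtr0_norm ?invr_gt0//.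
set n1 := `‖yosida a _‖; set n2 := `‖_ - _‖; set n3 := `‖smooth_comm a x‖.
set m1 := `‖_ + _‖; set m2 := `‖_ + _‖ => g1 g2.
have : a * m2 <= a * (a^-1 * n1 + n2 + n3) by rewrite ler_pM2l//; lra.
have -> : a * (a^-1 * n1 + n2 + n3) = n1 + a * n2 + a * n3 by field.
move: ae; rewrite /C; lra.
Qed.

(** Along approximate solutions in the common domain, [sum_le] makes [u n], [S (u n)] and [T (u n)]
    Cauchy separately; closedness of [S] and of [T] puts the limit in both domains. *)
Lemma sum_onto_shift (dS : dense (dom S)) mu : 48 * K <= mu ->
  onto_shift (op_sum S T) ('i * mu%:C).
Proof.
move=> muK y; have K1' := K1.
have H n : exists w, common_dom S T w /\
    `‖S w + T w + ('i * mu%:C) *: w - y‖ < n.+1%:R^-1.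
  have e0 : 0 < n.+1%:R^-1 / 2 :> R by rewrite divr_gt0.
  have [v Sv yv] := dense_approx y dS e0.
  have [w Fw wv] := sum_dense_range muK Sv e0; exists w; split=> //.
  have := rdist_trans (S w + T w + ('i * mu%:C) *: w) v y; rewrite (rdistC v y).
  by move: (n.+1%:R^-1) yv wv {e0} => d; lra.
have [u Hu] := choice H.
have Fu n : common_dom S T (u n) by case: (Hu n).
have Du : tends (fun n => S (u n) + T (u n) + ('i * mu%:C) *: u n) y.
  move=> e e0; exists (Num.truncn e^-1) => n Nn.
  apply: (lt_trans (Hu n).2).
  by rewrite invf_plt ?posrE// (lt_le_trans (truncnS_gt _))// ler_nat.
have FB m n : common_dom S T (u m - u n).
  have [h1 h2 h3 h4] := Fu m; have [g1 g2 g3 g4] := Fu n.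
  by split; rewrite ?opB//; exact: domB.
have le m n : [/\ `‖S (u m) - S (u n)‖ <= 2 * `‖S (u m) + T (u m) + ('i * mu%:C) *: u m -
      (S (u n) + T (u n) + ('i * mu%:C) *: u n)‖,
    `‖T (u m) - T (u n)‖ <= 2 * `‖S (u m) + T (u m) + ('i * mu%:C) *: u m -
      (S (u n) + T (u n) + ('i * mu%:C) *: u n)‖ &
    `‖u m - u n‖ <= 2 * `‖S (u m) + T (u m) + ('i * mu%:C) *: u m -
      (S (u n) + T (u n) + ('i * mu%:C) *: u n)‖].
  have [h1 h2 h3 h4] := Fu m; have [g1 g2 g3 g4] := Fu n.
  have := sum_le muK (FB m n); rewrite !opB//.
  have -> : S (u m) - S (u n) + (T (u m) - T (u n)) + ('i * mu%:C) *: (u m - u n) =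
    S (u m) + T (u m) + ('i * mu%:C) *: u m -
      (S (u n) + T (u n) + ('i * mu%:C) *: u n) by lmodule R E.
  move=> [l1 l2 l3]; split=> //; apply: le_trans l3.
  by rewrite ler_peMl ?rnorm_ge0//; lra.
have cauchy_of (v : nat -> E) : (forall m n, `‖v m - v n‖ <=
    2 * `‖S (u m) + T (u m) + ('i * mu%:C) *: u m -
      (S (u n) + T (u n) + ('i * mu%:C) *: u n)‖) -> cauchy_seq v.
  move=> vle e e0; have e2 : 0 < e / 2 by rewrite divr_gt0.
  have [N HN] := tends_cauchy Du e2; exists N => m n Nm Nn.
  by have := HN m n Nm Nn; have := vle m n; lra.
have [x ux] := cauchy_seq_tends (cauchy_of u (fun m n => let: And3 _ _ h := le m n in h)).
have [p Sup] := cauchy_seq_tends (cauchy_of (S \o u) (fun m n => let: And3 h _ _ := le m n in h)).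
have [q Tuq] := cauchy_seq_tends (cauchy_of (T \o u) (fun m n => let: And3 _ h _ := le m n in h)).
have Su n : dom S (u n) by case: (Fu n).
have Tu n : dom T (u n) by case: (Fu n).
have [Sx Sxp] := cS Su ux Sup; have [Tx Txq] := cT Tu ux Tuq.
exists x; split=> //=.
apply: (tends_uniq _ Du); apply: tendsD.
  by rewrite Sxp Txq; exact: tendsD.
apply: (tends_lip (c := `|mu|)) ux => n.
by rewrite -scalerBr rnormZir.
Qed.

End AntiCommutingEstimates.

(** * Passage from the core to the whole domain of [T] *)

Section CoreCondition.
Context (R : realType) (B : cstarAlgType R) (E : hilbertModType B).
Context (S T : operator E) (symS : op_symmetric S) (symT : op_symmetric T).
Context (cS : seq_closed S) (cT : seq_closed T).
Context (SO : forall a : R, a != 0 -> onto_shift S ('i * a%:C)).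

(** For symmetric [T] the graph norm of [x] equals [‖(T + i) x‖]. *)
Lemma graph_norm_ge (x : E) : dom T x ->
  `‖x‖%:C <= graph_norm T x /\ `‖T x‖%:C <= graph_norm T x.
Proof.
move=> Tx; have -> : graph_norm T x = `‖T x + ('i * (1 : R)%:C) *: x‖%:C.
  rewrite /graph_norm rnormE.
  have -> : inner x x + inner (T x) (T x) =
      inner (T x + ('i * (1 : R)%:C) *: x) (T x + ('i * (1 : R)%:C) *: x).
    by rewrite !innerE (symT Tx Tx); lmodule R B.
  by rewrite rnorm_inner rmorphXn sqrCK// ler0c rnorm_ge0.
rewrite !lecR; split; last exact: symmetric_op_le.
by have := shift_le symT 1 Tx; rewrite normr1 mul1r.
Qed.

(** Approximate [y] in graph norm by [v n] in the core and put [u n = (S + ia)^-1 (v n)]. Then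
    [T (u n)], next [k (u n)], and finally [S (T (u n))] converge, so closedness of [T] and [S]
    gives [x] in [dom T] and [T x] in [dom S]. *)
Lemma common_dom_core (M : set E) (K l0 : R) : is_core T M -> 1 <= K ->
  (forall x, common_dom S T x ->
    `‖anticomm S T x‖ <= K * (`‖x‖ + `‖S x‖ + `‖T x‖)) ->
  (forall a : R, l0 <= `|a| ->
    resolvent_image S ('i * a%:C) M `<=` common_dom S T) ->
  forall (a : R) (x : E), l0 <= `|a| -> 2 * K <= `|a| -> dom S x ->
    dom T (S x + ('i * a%:C) *: x) -> common_dom S T x.
Proof.
move=> [Msub MT Mdense] K1 kle HM a x la Ka Sx; set y := S x + _ => Ty.
have a0 : a != 0 by rewrite -normr_gt0; lra.
have H n : exists z, [/\ M z, `‖y - z‖ < n.+1%:R^-1 & `‖T y - T z‖ < n.+1%:R^-1].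
  have [|z Mz yz] := Mdense y Ty n.+1%:R^-1%:C; first by rewrite ltcR invr_gt0.
  have Tz := MT _ Mz.
  have [h1 h2] := graph_norm_ge (domB Ty Tz).
  exists z; split=> //; rewrite -ltcR.
    exact: le_lt_trans h1 yz.
  by rewrite -opB//; exact: le_lt_trans h2 yz.
have [v Hv] := choice H.
have Tv n : dom T (v n) by apply: MT; case: (Hv n).
pose u n := res S a (v n).
have Su n : dom S (u n) by exact: dom_res.
have uv n : S (u n) + ('i * a%:C) *: u n = v n by exact: (resP SO _ a0).2.
have Fu n : common_dom S T (u n).
  by apply: (HM a la); split=> //; rewrite uv; case: (Hv n).
have small : forall e : R, 0 < e -> exists N, forall n, (N <= n)%N -> n.+1%:R^-1 < e.
  move=> e e0; exists (Num.truncn e^-1) => n Nn.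
  by rewrite invf_plt ?posrE// (lt_le_trans (truncnS_gt _))// ler_nat.
have vy : tends v y.
  move=> e /small[N HN]; exists N => n /HN; apply: lt_trans.
  by rewrite rdistC; case: (Hv n).
have Tvy : tends (fun n => T (v n)) (T y).
  move=> e /small[N HN]; exists N => n /HN; apply: lt_trans.
  by rewrite rdistC; case: (Hv n).
have ux : tends u x.
  have -> : x = res S a y by exact: res_uniq.
  apply: (tends_lip (c := `|a|^-1)) vy => n.
  rewrite /u -(resB symS SO)// mulrC ler_pdivlMr ?normr_gt0// mulrC.
  exact: res_le.
have FB m n : common_dom S T (u m - u n).
  have [h1 h2 h3 h4] := Fu m; have [g1 g2 g3 g4] := Fu n.
  by split; rewrite ?opB//; exact: domB.
have key m n : `‖T (u m - u n)‖ <= 2 * K * `‖v m - v n‖ + `‖T (v m) - T (v n)‖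
   /\ `‖anticomm S T (u m - u n)‖ <=
     K * (2 * `‖v m - v n‖ + `‖T (u m - u n)‖).
  have [Sz Tz TSz STz] := FB m n; set z := u m - u n in Sz Tz TSz STz *.
  have zE : S z + ('i * a%:C) *: z = v m - v n.
    by rewrite /z opB// -!uv; lmodule R E.
  (* The lower bound for [S - ia] at [T z] gives [|a| ‖T z‖ <= ‖k z‖ + ‖T (v m) - T (v n)‖]. The
     part [K ‖T z‖] of the bound on [k z] is absorbed because [2 K <= |a|]. *)
  have e1 : S (T z) + ('i * (- a)%:C) *: T z = anticomm S T z - (T (v m) - T (v n)).
    rewrite -opB// -zE /anticomm opD ?opZ//; first by lmodule R E.
    exact: domZ.
  have := shift_le symS (- a) STz; rewrite e1 normrN.
  have := rnormB (anticomm S T z) (T (v m) - T (v n)).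
  have := kle z (FB m n).
  have := shift_le symS a Sz; have := symmetric_op_le a symS Sz; rewrite zE.
  have := rnorm_ge0 z; have := rnorm_ge0 (T z).
  move: (`‖T z‖) (`‖z‖) (`‖S z‖) (`‖v m - v n‖) (`‖T (v m) - T (v n)‖).
  move=> t z' s w tw t0 z0 sw zw h1 h2 h3.
  have z1 : z' <= `|a| * z' by rewrite ler_peMl//; lra.
  have h4 : K * (z' + s + t) <= K * (2 * w + t) by rewrite ler_wpM2l//; lra.
  have h5 : 2 * K * t <= `|a| * t by rewrite ler_wpM2r.
  have h6 : t <= K * t by rewrite ler_peMl.
  by split; lra.
have TuC : cauchy_seq (fun n => T (u n)).
  move=> e e0.
  have e1 : 0 < e / (4 * K) by rewrite divr_gt0// mulr_gt0//; lra.
  have e2 : 0 < e / 2 by rewrite divr_gt0.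
  have [N HN] := tends_cauchy vy e1; have [N' HN'] := tends_cauchy Tvy e2.
  exists (maxn N N') => m n; rewrite !geq_max => /andP[Nm N'm] /andP[Nn N'n].
  have := HN m n Nm Nn; rewrite ltr_pdivlMr; last by lra.
  have := HN' m n N'm N'n; have := (key m n).1.
  have [_ Tm _ _] := Fu m; have [_ Tn _ _] := Fu n; rewrite opB//.
  lra.
have [q Tuq] := cauchy_seq_tends TuC.
have Tu n : dom T (u n) by case: (Fu n).
have [Tx Txq] := cT Tu ux Tuq.
have kC : cauchy_seq (fun n => anticomm S T (u n)).
  move=> e e0.
  have e1 : 0 < e / (4 * K) by rewrite divr_gt0// mulr_gt0//; lra.
  have e2 : 0 < e / (2 * K) by rewrite divr_gt0// mulr_gt0//; lra.
  have [N HN] := tends_cauchy vy e1; have [N' HN'] := TuC _ e2.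
  exists (maxn N N') => m n; rewrite !geq_max => /andP[Nm N'm] /andP[Nn N'n].
  have := HN m n Nm Nn; rewrite ltr_pdivlMr; last by lra.
  have := HN' m n N'm N'n; rewrite ltr_pdivlMr; last by lra.
  have := (key m n).2.
  have [Sm Tm TSm STm] := Fu m; have [Sn Tn TSn STn] := Fu n.
  have -> : anticomm S T (u m - u n) = anticomm S T (u m) - anticomm S T (u n).
    by rewrite /anticomm !opB//; lmodule R E.
  rewrite opB//; lra.
have [kap kuk] := cauchy_seq_tends kC.
have STu n : dom S (T (u n)) by case: (Fu n).
have lim : tends (fun n => S (T (u n))) (kap + ((-1 : R[i]) *: T y + ('i * a%:C) *: q)).
  have -> : (fun n => S (T (u n))) = (fun n => anticomm S T (u n) +
     ((-1 : R[i]) *: T (v n) + ('i * a%:C) *: T (u n))).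
    apply/funext => n; have [Sn Tn TSn STn] := Fu n.
    rewrite -uv opD ?opZ//; last exact: domZ.
    by rewrite /anticomm; lmodule R E.
  apply: (tendsD kuk); apply: tendsD.
    apply: (tends_lip (c := 1)) Tvy => n.
    by rewrite -scalerBr scaleN1r rnormN mul1r.
  apply: (tends_lip (c := `|a|)) Tuq => n.
  by rewrite -scalerBr rnormZir.
have [STx _] := cS STu Tuq lim.
split=> //; last by rewrite Txq.
have -> : S x = y - ('i * a%:C) *: x by rewrite /y addrK.
by apply: domB => //; exact: domZ.
Qed.

End CoreCondition.

(** * Change of sign of an operator *)

Section Opposite.
Context (R : realType) (B : cstarAlgType R) (E : hilbertModType B).
Context (A : operator E).

Lemma opp_opD (x y : E) : dom A x -> dom A y -> - A (x + y) = - A x + - A y.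
Proof. by move=> Ax Ay; rewrite opD// opprD. Qed.

Lemma opp_opZ (l : R[i]) (x : E) : dom A x -> - A (l *: x) = l *: - A x.
Proof. by move=> Ax; rewrite opZ// scalerN. Qed.

Lemma bactN (x : E) (b : B) : bact (- x) b = - bact x b.
Proof. by rewrite -scaleN1r bactZl scaleN1r. Qed.

Lemma opp_op_bact (x : E) (b : B) : dom A x -> - A (bact x b) = bact (- A x) b.
Proof. by move=> Ax; rewrite op_bact// bactN. Qed.

Definition op_opp : operator E :=
  @Operator R B E (dom A) (fun x => - A x) (dom_submodule A)
    opp_opD opp_opZ opp_op_bact.

Lemma op_opp_symmetric : op_symmetric A -> op_symmetric op_opp.
Proof. by move=> sA x y Ax Ay; rewrite /= innerNl innerNr sA. Qed.

Lemma op_opp_closed : seq_closed A -> seq_closed op_opp.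
Proof.
move=> cA u x y Au ux uy /=.
have [|Ax ->] := cA u x (- y) Au ux; last by rewrite opprK.
move=> e /uy[N HN]; exists N => n /HN /=.
have -> : A (u n) - - y = - (- A (u n) - y) by rewrite opprD !opprK.
by rewrite rnormN.
Qed.

Lemma op_opp_onto_shift z : onto_shift A z -> onto_shift op_opp (- z).
Proof.
move=> oA y; have [x [Ax xy]] := oA (- y); exists x; split=> //=.
by rewrite scaleNr -opprD xy opprK.
Qed.

End Opposite.

(** * Self-adjointness and regularity of [S + T] *)

Theorem theorem1p1 (R : realType) (B : cstarAlgType R) (E : hilbertModType B)
    (S T : operator E)
    (S_sa : self_adjoint S) (S_reg : regular S)
    (T_sa : self_adjoint T) (T_reg : regular T)
    (commutator_bound : exists C0 C1 C2 : R, [/\ 0 < C0, 0 < C1, 0 < C2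
      & forall x : E, common_dom S T x ->
          cstar_le (inner (anticomm S T x) (anticomm S T x))
            (C0%:C *: inner x x + C1%:C *: inner (S x) (S x)
             + C2%:C *: inner (T x) (T x))])
    (core_condition : exists (M : set E) (l0 : R), [/\ is_core T M, 0 < l0
      & forall l : R[i], complex.Re l = 0 -> l0%:C <= `|l| ->
          resolvent_image S l M `<=` common_dom S T]) :
  [/\ self_adjoint (op_sum S T), regular (op_sum S T)
    & forall (z : R[i]) (y : E), complex.Im z != 0 ->
        exists! x : E, (dom S `&` dom T) x /\ S x + T x + z *: x = y].
Proof.
have [C0 [C1 [C2 [C00 C10 C20 Hk]]]] := commutator_bound.
have [M [l0 [coreM l00 HM]]] := core_condition.
have symS := self_adjoint_symmetric S_sa.
have symT := self_adjoint_symmetric T_sa.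
have cS := self_adjoint_closed S_sa; have cT := self_adjoint_closed T_sa.
have Im_i (a : R) : a != 0 -> complex.Im ('i * a%:C) != 0.
  by rewrite /= mul0r mul1r add0r.
have SO (a : R) : a != 0 -> onto_shift S ('i * a%:C).
  by move=> /Im_i; exact: regular_onto_shift.
have TO (a : R) : a != 0 -> onto_shift T ('i * a%:C).
  by move=> /Im_i; exact: regular_onto_shift.
(* The summand 1 gives [K <= K^2], so the bound [K t^2] on squares yields the bound [K t] on norms
   without a square root. *)
pose K := 1 + C0 + C1 + C2.
have K1 : 1 <= K by rewrite /K; lra.
have kle x : common_dom S T x ->
    `‖anticomm S T x‖ <= K * (`‖x‖ + `‖S x‖ + `‖T x‖).
  move=> /Hk[c hc]; have := sqr_rnorm_le_inner (anticomm S T x) (pos_cstarM c).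
  rewrite -hc addrC subrK => h.
  have h0 := rnorm_ge0 x; have h1 := rnorm_ge0 (S x); have h2 := rnorm_ge0 (T x).
  have K0 : 0 <= K by lra.
  have s0 : 0 <= `‖x‖ + `‖S x‖ + `‖T x‖ by rewrite !addr_ge0.
  rewrite -ler_sqr ?nnegrE ?rnorm_ge0 ?mulr_ge0//.
  apply: (le_trans h).
  have := rnormD (C0%:C *: inner x x + C1%:C *: inner (S x) (S x))
    (C2%:C *: inner (T x) (T x)).
  have := rnormD (C0%:C *: inner x x) (C1%:C *: inner (S x) (S x)).
  rewrite !rnormZ !gtr0_norm// !rnorm_inner.
  move: (`‖x‖) (`‖S x‖) (`‖T x‖) h0 h1 h2 => p q r p0 q0 r0 g1 g2.
  set t := p + q + r.
  have t0 : 0 <= t by rewrite !addr_ge0.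
  have tp : p ^+ 2 <= t ^+ 2 by rewrite ler_sqr ?nnegrE// /t; lra.
  have tq : q ^+ 2 <= t ^+ 2 by rewrite ler_sqr ?nnegrE// /t; lra.
  have tr : r ^+ 2 <= t ^+ 2 by rewrite ler_sqr ?nnegrE// /t; lra.
  have : C0 * p ^+ 2 <= C0 * t ^+ 2 by rewrite ler_pM2l.
  have : C1 * q ^+ 2 <= C1 * t ^+ 2 by rewrite ler_pM2l.
  have : C2 * r ^+ 2 <= C2 * t ^+ 2 by rewrite ler_pM2l.
  have : K * t ^+ 2 <= K ^+ 2 * t ^+ 2.
    by rewrite ler_wpM2r ?sqr_ge0// expr2 ler_peMl//; lra.
  have : K * t ^+ 2 = t ^+ 2 + C0 * t ^+ 2 + C1 * t ^+ 2 + C2 * t ^+ 2.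
    by rewrite /K; ring.
  rewrite exprMn; have := sqr_ge0 t.
  move: (K * _) (K ^+ 2 * _) => m1 m2; lra.
have HM' (a : R) : l0 <= `|a| ->
    resolvent_image S ('i * a%:C) M `<=` common_dom S T.
  move=> la; apply: HM; first by rewrite /= mul0r mulr0 subr0.
  rewrite normrM normc_def /= expr0n add0r expr1n sqrtr1 mul1r.
  by rewrite normc_def /= expr0n addr0 sqrtr_sqr lecR.
have resF := common_dom_core symS symT cS cT SO coreM K1 kle HM'.
pose a0 := Num.max l0 (2 * K).
have a0K : 2 * K <= a0 by rewrite le_max lexx orbT.
have res_common (a : R) (x : E) : a0 <= `|a| -> dom S x ->
    dom T (S x + ('i * a%:C) *: x) -> common_dom S T x.
  by rewrite ge_max => /andP[h1 h2]; exact: resF.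
have dS : dense (dom S) by case: S_sa.
have dT : dense (dom T) by case: T_sa.
have pos_onto := sum_onto_shift symS symT cS cT SO TO K1 a0K kle res_common dS.
(* The estimates require [mu > 0]. The pair [- S], [- T] has the same anticommutator and satisfies
   the same hypotheses, and its shift by [i mu] is minus the shift of [S + T] by [- i mu]. *)
have neg_onto mu : 48 * K <= mu -> onto_shift (op_sum S T) (- ('i * mu%:C)).
  move=> muK.
  have opp_onto (A : operator E) : (forall a : R, a != 0 -> onto_shift A ('i * a%:C)) ->
      forall a : R, a != 0 -> onto_shift (op_opp A) ('i * a%:C).
    move=> AO a an0; have := op_opp_onto_shift (AO (- a) _).
    by rewrite oppr_eq0 rmorphN mulrN opprK; apply.
  have opp_kle x : common_dom (op_opp S) (op_opp T) x ->
     `‖anticomm (op_opp S) (op_opp T) x‖ <=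
     K * (`‖x‖ + `‖op_opp S x‖ + `‖op_opp T x‖).
    move=> [/= Sx Tx TSx STx].
    rewrite -(opprK (S x)) in TSx *; rewrite -(opprK (T x)) in STx *.
    move: (domN TSx) (domN STx); rewrite !opprK in TSx STx * => TSx' STx'.
    have := kle x (And4 Sx Tx TSx' STx').
    by rewrite /anticomm /= !opN// !opprK !rnormN.
  have opp_res (a : R) (x : E) : a0 <= `|a| -> dom (op_opp S) x ->
      dom (op_opp T) (op_opp S x + ('i * a%:C) *: x) ->
      common_dom (op_opp S) (op_opp T) x.
    move=> /= aa Sx /domN; rewrite opprD opprK => Th.
    have [||h1 h2 h3 h4] := @res_common (- a) x _ Sx; first by rewrite normrN.
      by rewrite rmorphN mulrN scaleNr.
    by split=> //=; exact: domN.
  have := sum_onto_shift (op_opp_symmetric symS) (op_opp_symmetric symT)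
    (op_opp_closed cS) (op_opp_closed cT) (opp_onto _ SO) (opp_onto _ TO)
    K1 a0K opp_kle opp_res dS muK.
  move=> onto y; have [x [Dx xy]] := onto (- y); exists x; split=> //.
  by rewrite -[RHS]opprK -xy /= scaleNr !opprD !opprK.
have symD : op_symmetric (op_sum S T).
  by move=> x y [Sx Tx] [Sy Ty]; rewrite /= !innerE symS// symT.
have onto z : complex.Im z != 0 -> onto_shift (op_sum S T) z.
  have K0 : 0 < 48 * K by lra.
  rewrite neq_lt => /orP[z0|z0].
    apply: (onto_shift_all symD (neg_onto _ (lexx _))).
    by rewrite /= mul0r mul1r add0r mulNr oppr_gt0 pmulr_rlt0.
  apply: (onto_shift_all symD (pos_onto _ (lexx _))).
  by rewrite /= mul0r mul1r add0r mulr_gt0.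
have dD : dense (dom (op_sum S T)).
  have dF := dense_common symS SO K1 a0K res_common dS dT.
  apply: approx_dense => x e e0; have [y [Sy Ty _ _] xy] := dense_approx x dF e0.
  by exists y.
have [sa reg] := onto_shift_self_adjoint symD dD onto.
split=> // z y z0; have [x [Dx xy]] := onto z z0 y.
exists x; split=> // x' [Dx' xy'].
apply/eqP; rewrite -subr_eq0; apply/eqP/rnorm_eq0/eqP.
have := symmetric_shift_le z symD (domB Dx Dx'); rewrite opB//.
have -> : op_sum S T x - op_sum S T x' + z *: (x - x') = 0.
  by rewrite scalerBr addrACA -opprD xy -xy' /= subrr.
rewrite rnorm0 pmulr_rle0 ?normr_gt0// => le0.
by rewrite eq_le le0 rnorm_ge0.
Qed.
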